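(* Let $\Lambda=(\Lambda_1,\ldots,\Lambda_m;\Lambda_{m+1},\ldots,\Lambda_\ell)$ be a superpartition of $(n|m)$ (with $\ell=\ell(\Lambda)$) and let $\Lambda'$ be its conjugate. Then, in the ring of symmetric superfunctions in infinitely many variables, $$\tilde e_{\Lambda_m}\cdots\tilde e_{\Lambda_1}\,e_{\Lambda_{m+1}}\cdots e_{\Lambda_\ell}\;=\;m_{\Lambda'}+\sum_{\Omega\in \mathrm{SPar}(n|m),\ \Omega<\Lambda'}N^{\Omega}_{\Lambda}\,m_\Omega ,$$ where each $N^{\Omega}_{\Lambda}$ is an integer and $<$ is the (strict) Bruhat order on superpartitions. Consequently $\{e_\Lambda:\Lambda\in\mathrm{SPar}(n|m)\}$ is a basis of the $\mathbb{Z}$-module $\mathscr{P}^{S_\infty}_{(n|m)}(\mathbb{Z})$.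
   Context: Variables: $x_1,x_2,\ldots$ commute; $\theta_1,\theta_2,\ldots$ anticommute ($\theta_i\theta_j=-\theta_j\theta_i$, so $\theta_i^2=0$) and commute with the $x$'s. A superpartition of $(n|m)$ is $\Lambda=(\Lambda_1,\ldots,\Lambda_m;\Lambda_{m+1},\Lambda_{m+2},\ldots)$ with $\Lambda_1>\cdots>\Lambda_m\ge0$, $\Lambda_{m+1}\ge\Lambda_{m+2}\ge\cdots\ge0$ (finitely many nonzero), $\sum_i\Lambda_i=n$; $\Lambda^a=(\Lambda_1,\ldots,\Lambda_m)$, $\Lambda^s=(\Lambda_{m+1},\ldots)$. $\mathrm{SPar}(n|m)$ is the set of these. $\ell(\Lambda)=m+\#\{\text{nonzero entries of }\Lambda^s\}$. $\Lambda^*$ is the partition obtained by reordering all entries of $\Lambda$ in nonincreasing order. $C[\Lambda]$ is $\Lambda^*$ with the entries coming from $\Lambda^a$ circled (if a value $b$ of $\Lambda^a$ also occurs in $\Lambda^s$, the leftmost $b$ is circled). $D[\Lambda]$ is the Ferrers diagram of $C[\Lambda]$ (row $j$ has $C[\Lambda]_j$ boxes, rows left justified, possibly empty rows for a circled $0$) with a circle appended at the end of each row $j$ whose entry is circled. The conjugate $\Lambda'$ is the superpartition whose diagram is the transpose of $D[\Lambda]$ (circles included); it lies in $\mathrm{SPar}(n|m)$. Bruhat order: for a composition $\lambda$ (finite sequence of nonnegative integers) let $\lambda^+$ be its nonincreasing rearrangement and $w_\lambda$ the permutation of minimal length with $\lambda=w_\lambda\lambda^+$. For compositions $\lambda,\mu$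 of $n$ with the same number of entries, $\lambda\ge\mu$ iff either $\lambda^+>\mu^+$ in dominance order, or $\lambda^+=\mu^+$ and $w_\lambda\le w_\mu$ in the Bruhat order of the symmetric group. For superpartitions $\Lambda,\Omega$ of $(n|m)$, let $\Lambda^c$ be the composition obtained by replacing the semicolon by a comma (padding symmetric parts with zeros to equal lengths); $\Omega\le\Lambda$ iff $\Omega^c\le\Lambda^c$. Monomials: in $N$ variables, for $\Lambda\in\mathrm{SPar}(n|m)$ with $\ell(\Lambda)\le N$ written with $N$ entries, $m_\Lambda=\frac{1}{n_\Lambda!}\sum_{\sigma\in S_N}\mathcal K_\sigma(\theta_1\cdots\theta_m x_1^{\Lambda_1}\cdots x_N^{\Lambda_N})$, where $\mathcal K_\sigma$ permutes the $x$'s and the $\theta$'s simultaneously ($x_i\mapsto x_{\sigma(i)},\theta_i\mapsto\theta_{\sigma(i)}$) and $n_\Lambda!=\prod_{i\ge0}n_{\Lambda^s}(i)!$ with $n_{\Lambda^s}(i)$ the number of entries of $(\Lambda_{m+1},\ldots,\Lambda_N)$ equal to $i$; in infinitely many variables $m_\Lambda$ is the corresponding stable formal sum. $\mathscr{P}^{S_\infty}_{(n|m)}(\mathbb Z)$ is the $\mathbb Z$-span of $\{m_\Lambda:\Lambda\in\mathrm{SPar}(n|m)\}$ (symmetric superfunctions of degree $n$ in $x$ and $m$ in $\theta$). Elementary functions: $e_0=1$, $e_n=\sum_{j_1<\cdots<j_n}x_{j_1}\cdots x_{j_n}$, $\tilde e_n=\sum_i\theta_i\sum_{j_1<\cdots<j_n,\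 i\notin\{j_k\}}x_{j_1}\cdots x_{j_n}$ ($n\ge0$; $\tilde e_0=\sum_i\theta_i$). For a superpartition $\Lambda$ of fermionic degree $m$: $e_\Lambda=\tilde e_{\Lambda_1}\cdots\tilde e_{\Lambda_m}e_{\Lambda_{m+1}}\cdots e_{\Lambda_{\ell(\Lambda)}}$ (product taken left to right). *)

(* Defs.v *)
From HB Require Import structures.
From mathcomp Require Import all_boot all_order all_algebra all_fingroup.
From mathcomp Require Import finmap.
From mathcomp.classical Require Import boolp.

Set Implicit Arguments.
Unset Strict Implicit.
Unset Printing Implicit Defensive.

Import Order.TTheory GRing.Theory Num.Theory.

Local Open Scope fset_scope.
Local Open Scope ring_scope.

(* Monomials theta_S x^a in the variables x_0, x_1, ... and
   theta_0, theta_1, ...: the pair (S, a) with S a finite set, standing for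
   theta_(i1) ... theta_(ik) with i1 < ... < ik, and a : nat -> nat of finite
   support. *)
Definition xmon := {fsfun nat -> nat with 0%N}.
Definition smon := ({fset nat} * xmon)%type.

Definition xmon1 : xmon := [fsfun in fset0 => 0%N].
Definition xmonU (i : nat) : xmon := [fsfun j in [fset i] => 1%N].
Definition xmonM (a b : xmon) : xmon :=
  [fsfun i in finsupp a `|` finsupp b => (a i + b i)%N].
Definition xmonB (a b : xmon) : xmon :=
  [fsfun i in finsupp a => (a i - b i)%N].
Definition xdivs (a : xmon) : {fset xmon} :=
  [fset b in [seq ([fsfun i : finsupp a => (c i : nat)] : xmon)
               | c : {dffun forall i : finsupp a, 'I_(a (val i)).+1}]].

Definition sdivs (u : smon) : {fset smon} := fpowerset u.1 `*` xdivs u.2.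
Definition squo (u v : smon) : smon := (u.1 `\` v.1, xmonB u.2 v.2).

(* theta_S theta_T = (-1)^(sinv S T) theta_(S `|` T) for S, T disjoint *)
Definition sinv (S T : {fset nat}) : nat :=
  (\sum_(i <- S) \sum_(j <- T) (j < i))%N.

(* Formal superseries in infinitely many variables, given by their
   coefficients. *)
Definition sser := smon -> rat.

Lemma xmonME (a b : xmon) i : xmonM a b i = (a i + b i)%N.
Proof.
rewrite fsfunE in_fsetU; case: finsuppP => [_|_] //=.
by case: finsuppP.
Qed.

Lemma xmonBE (a b : xmon) i : xmonB a b i = (a i - b i)%N.
Proof. by rewrite fsfunE; case: finsuppP. Qed.

Lemma xmonUE i j : xmonU i j = (j == i) :> nat.
Proof. by rewrite fsfunE in_fset1; case: (j == i). Qed.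

Lemma xmon1E i : xmon1 i = 0%N.
Proof. by rewrite fsfunE in_fset0. Qed.

Lemma mem_xdivs (a b : xmon) : reflect (forall i, (b i <= a i)%N) (b \in xdivs a).
Proof.
rewrite inE /=; apply: (iffP imageP) => [[c _ ->] i|leba].
  rewrite fsfun_ffun; case: insubP => //= u _ <-.
  by rewrite -ltnS ltn_ord.
exists [ffun i : finsupp a => Ordinal (leba (val i) : (_ < (a (val i)).+1)%N)] => //.
apply/fsfunP => i; rewrite fsfun_ffun; case: insubP => /= [u _ <-|].
  by rewrite ffunE.
move/fsfun_dflt => ai0; apply/eqP; rewrite -leqn0.
by apply: leq_trans (leba i) _; rewrite ai0.
Qed.

Lemma sdvdP (v u : smon) :
  reflect (v.1 `<=` u.1 /\ forall i, (v.2 i <= u.2 i)%N) (v \in sdivs u).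
Proof.
rewrite in_fsetM fpowersetE; apply: (iffP andP) => -[? ?]; split => //.
  exact/mem_xdivs.
exact/mem_xdivs.
Qed.

Definition smonM (u v : smon) : smon := (u.1 `|` v.1, xmonM u.2 v.2).

Lemma fsetUDK_ (S T : {fset nat}) : S `<=` T -> S `|` (T `\` S) = T.
Proof.
move=> ST; apply/fsetP => i; rewrite in_fsetU in_fsetD.
by case: (boolP (i \in S)) => //= /(fsubsetP ST) ->.
Qed.

Lemma fdisjointDr_ (S T : {fset nat}) : [disjoint S & T `\` S].
Proof. by apply/fdisjointP => i iS; rewrite in_fsetD iS. Qed.

Lemma perm_fsetU (S T : {fset nat}) :
  [disjoint S & T] -> perm_eq (S `|` T) (S ++ T).
Proof.
move=> dST; apply: uniq_perm; rewrite ?fset_uniq //.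
  rewrite cat_uniq !fset_uniq andbT /=; apply/hasPn => i iT.
  by apply/negP => iS; move/fdisjointP: dST => /(_ i iS); rewrite iT.
by move=> i; rewrite mem_cat in_fsetU.
Qed.

Lemma sinvUl (S T U : {fset nat}) :
  [disjoint S & T] -> sinv (S `|` T) U = (sinv S U + sinv T U)%N.
Proof. by move=> dST; rewrite /sinv (perm_big _ (perm_fsetU dST)) big_cat. Qed.

Lemma sinvUr (S T U : {fset nat}) :
  [disjoint T & U] -> sinv S (T `|` U) = (sinv S T + sinv S U)%N.
Proof.
move=> dTU; rewrite /sinv -big_split; apply: eq_bigr => i _ /=.
by rewrite (perm_big _ (perm_fsetU dTU)) big_cat.
Qed.

Lemma sdivs_trans (u t v : smon) : t \in sdivs u -> v \in sdivs t -> v \in sdivs u.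
Proof.
move=> /sdvdP[S1 l1] /sdvdP[S2 l2]; apply/sdvdP; split=> [|i].
  exact: fsubset_trans S2 S1.
exact: leq_trans (l2 i) (l1 i).
Qed.

Lemma smon_eqP (u v : smon) : u.1 = v.1 -> u.2 =1 v.2 -> u = v.
Proof. by case: u v => [S a] [T b] /= -> /fsfunP ->. Qed.

Lemma smonM_divs (u v w : smon) : v \in sdivs u -> w \in sdivs (squo u v) ->
  [/\ smonM v w \in sdivs u, v \in sdivs (smonM v w),
      squo (smonM v w) v = w & squo u (smonM v w) = squo (squo u v) w].
Proof.
move=> /sdvdP[vu lvu] /sdvdP /= [wuv lwuv].
have dvw : [disjoint v.1 & w.1].
  apply/fdisjointP => i iv; apply/negP => /(fsubsetP wuv).
  by rewrite in_fsetD iv.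
split.
- apply/sdvdP; split => /= [|i].
    rewrite fsubUset vu /=; apply: fsubset_trans wuv _; exact: fsubsetDl.
  rewrite xmonME; have := lwuv i; rewrite xmonBE.
  by have := lvu i; move/subnK => {2}<-; rewrite addnC leq_add2r.
- apply/sdvdP; split => /= [|i]; first exact: fsubsetUl.
  by rewrite xmonME leq_addr.
- apply: smon_eqP => /= [|i].
    apply/fsetP => i; rewrite in_fsetD in_fsetU.
    case iv: (i \in v.1) => //=.
    by apply/esym/negP => iw; move/fdisjointP: dvw => /(_ i iv); rewrite iw.
  by rewrite xmonBE xmonME addKn.
- apply: smon_eqP => /= [|i].
    by rewrite fsetDDl.
  by rewrite !xmonBE xmonME subnDA.
Qed.

Lemma squo_divs (u t v : smon) : t \in sdivs u -> v \in sdivs t ->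
  squo t v \in sdivs (squo u v) /\ smonM v (squo t v) = t.
Proof.
move=> /sdvdP[tu ltu] /sdvdP[vt lvt]; split.
  apply/sdvdP; split => /= [|i]; first exact: fsetSD.
  by rewrite !xmonBE leq_sub2r.
apply: smon_eqP => /= [|i]; first by exact: fsetUDK_.
by rewrite xmonME xmonBE subnKC.
Qed.

Definition sser_mul (f g : sser) : sser := fun u =>
  \sum_(v <- sdivs u)
     (-1) ^+ sinv v.1 (squo u v).1 * f v * g (squo u v).

Lemma sser_mulA : associative sser_mul.
Proof.
move=> f g h; apply: functional_extensionality_dep => u; rewrite /sser_mul.
cbv beta.
under eq_bigr do rewrite mulr_sumr.
under [RHS]eq_bigr do rewrite mulr_sumr mulr_suml.
have divE t : t \in sdivs u ->
    perm_eq (sdivs t) [seq v <- sdivs u | v \in sdivs t].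
  move=> tu; apply: uniq_perm; rewrite ?filter_uniq ?fset_uniq // => v.
  rewrite mem_filter; case vt: (v \in sdivs t) => //=.
  by rewrite (sdivs_trans tu vt).
rewrite [RHS]big_seq.
under [RHS]eq_bigr => t tu do rewrite (perm_big _ (divE t tu)) big_filter.
rewrite -[RHS]big_seq [RHS](exchange_big_dep xpredT) // [LHS]big_seq [RHS]big_seq.
apply: eq_bigr => v vu; rewrite -[RHS]big_filter.
have pE : perm_eq [seq t <- sdivs u | v \in sdivs t]
    [seq smonM v w | w <- sdivs (squo u v)].
  apply: uniq_perm; rewrite ?filter_uniq ?fset_uniq //.
    rewrite map_inj_in_uniq ?fset_uniq // => w1 w2 w1P w2P e.
    have [_ _ <- _] := smonM_divs vu w1P.
    by have [_ _ <- _] := smonM_divs vu w2P; rewrite e.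
  move=> t; rewrite mem_filter; apply/andP/mapP => [[vt tu]|[w wP ->]].
    have [qP e] := squo_divs tu vt.
    by exists (squo t v); rewrite ?e.
  by have [-> ->] := smonM_divs vu wP.
rewrite (perm_big _ pE) big_map big_seq [RHS]big_seq.
apply: eq_bigr => w wP; have [wu vw e1 e2] := smonM_divs vu wP.
rewrite e1 e2; set z := squo (squo u v) w.
have [/sdvdP[vS _] /sdvdP[wS _]] := (vu, wP).
have dwz : [disjoint w.1 & z.1] by apply: fdisjointDr_.
have dvw : [disjoint v.1 & w.1].
  by apply: fdisjointWr wS _; apply: fdisjointDr_.
have eS : (squo u v).1 = w.1 `|` z.1 by rewrite /z /= fsetUDK_.
rewrite -/z eS sinvUr // (sinvUl _ dvw : sinv (smonM v w).1 z.1 = _) !exprD.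
set a := (-1) ^+ _; set b := (-1) ^+ _; set c := (-1) ^+ _.
by rewrite -!mulrA [f v * (c * _)]mulrCA [c * (a * _)]mulrCA [b * (a * _)]mulrCA.
Qed.

Definition smon1 : smon := (fset0, xmon1).

(* the series reduced to one monomial *)
Definition sdelta (u : smon) : sser := fun v => (v == u)%:R.

Lemma smon1_div u : smon1 \in sdivs u.
Proof. by apply/sdvdP; rewrite fsub0set; split=> // i; rewrite xmon1E. Qed.

Lemma smon_div u : u \in sdivs u.
Proof. exact/sdvdP. Qed.

Lemma squo1 u : squo u smon1 = u.
Proof.
apply: smon_eqP => [|i]; first exact: fsetD0.
by rewrite xmonBE xmon1E subn0.
Qed.

Lemma squoxx u : squo u u = smon1.
Proof.
apply: smon_eqP => [|i]; first exact: fsetDv.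
by rewrite xmonBE xmon1E subnn.
Qed.

Lemma squo_eq1 u v : v \in sdivs u -> (squo u v == smon1) = (v == u).
Proof.
move=> vu; apply/eqP/eqP => [e|->]; last exact: squoxx.
have [_ <-] := squo_divs (smon_div u) vu.
apply: smon_eqP => [|i]; rewrite e; first by rewrite /= fsetU0.
by rewrite xmonME xmon1E addn0.
Qed.

Lemma sinv0l S : sinv fset0 S = 0%N.
Proof. by rewrite /sinv big_seq_fset0. Qed.

Lemma sinv0r S : sinv S fset0 = 0%N.
Proof. by rewrite /sinv big1 // => i _; rewrite big_seq_fset0. Qed.

Lemma sser_mul1 : left_id (sdelta smon1) sser_mul.
Proof.
move=> f; apply: functional_extensionality_dep => u.
rewrite /sser_mul (bigD1_seq smon1) ?smon1_div ?fset_uniq //=.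
rewrite squo1 sinv0l /sdelta eqxx !mul1r big1 ?addr0 // => v /negPf ->.
by rewrite mulr0 mul0r.
Qed.

Lemma sser_mulr1 : right_id (sdelta smon1) sser_mul.
Proof.
move=> f; apply: functional_extensionality_dep => u.
rewrite /sser_mul (bigD1_seq u) ?smon_div ?fset_uniq //.
rewrite squoxx (sinv0r _ : sinv _ smon1.1 = _) /sdelta eqxx mul1r mulr1 big_seq_cond big1 /= ?addr0 //.
by move=> v /andP[vu /negPf vNu]; rewrite squo_eq1 // vNu mulr0.
Qed.

Definition sser_add (f g : sser) : sser := fun u => f u + g u.
Definition sser_opp (f : sser) : sser := fun u => - f u.
Definition sser_scale (c : rat) (f : sser) : sser := fun u => c * f u.

Ltac sser_ext := apply: functional_extensionality_dep => u.

Lemma sser_addA : associative sser_add.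
Proof. by move=> f g h; sser_ext; rewrite /sser_add addrA. Qed.
Lemma sser_addC : commutative sser_add.
Proof. by move=> f g; sser_ext; rewrite /sser_add addrC. Qed.
Lemma sser_add0 : left_id ((fun=> 0) : sser) sser_add.
Proof. by move=> f; sser_ext; rewrite /sser_add add0r. Qed.
Lemma sser_addN : left_inverse ((fun=> 0) : sser) sser_opp sser_add.
Proof. by move=> f; sser_ext; rewrite /sser_add /sser_opp addNr. Qed.

HB.instance Definition _ := Choice.copy sser (smon -> rat).
HB.instance Definition _ :=
  GRing.isZmodule.Build sser sser_addA sser_addC sser_add0 sser_addN.

Lemma sser_mulDl : left_distributive sser_mul sser_add.
Proof.
move=> f g h; sser_ext; rewrite /sser_mul /sser_add -big_split.
by apply: eq_bigr => v _; rewrite mulrDr mulrDl.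
Qed.
Lemma sser_mulDr : right_distributive sser_mul sser_add.
Proof.
move=> f g h; sser_ext; rewrite /sser_mul /sser_add -big_split.
by apply: eq_bigr => v _; rewrite mulrDr.
Qed.
Lemma sser_1neq0 : sdelta smon1 != 0 :> sser.
Proof.
apply/eqP => /(congr1 (fun f : sser => f smon1)) /eqP.
by rewrite /sdelta eqxx.
Qed.

HB.instance Definition _ := GRing.Zmodule_isNzRing.Build sser
  sser_mulA sser_mul1 sser_mulr1 sser_mulDl sser_mulDr sser_1neq0.

Lemma sser_scaleA c d f : sser_scale c (sser_scale d f) = sser_scale (c * d) f.
Proof. by sser_ext; rewrite /sser_scale mulrA. Qed.
Lemma sser_scale1 : left_id 1 sser_scale.
Proof. by move=> f; sser_ext; rewrite /sser_scale mul1r. Qed.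
Lemma sser_scaleDr : right_distributive sser_scale sser_add.
Proof. by move=> c f g; sser_ext; rewrite /sser_scale /sser_add mulrDr. Qed.
Lemma sser_scaleDl f : {morph sser_scale^~ f : c d / c + d >-> sser_add c d}.
Proof. by move=> c d; sser_ext; rewrite /sser_scale /sser_add mulrDl. Qed.

HB.instance Definition _ := GRing.Zmodule_isLmodule.Build rat sser
  sser_scaleA sser_scale1 sser_scaleDr sser_scaleDl.

Definition theta (i : nat) : sser := sdelta ([fset i], xmon1).
Definition xvar (i : nat) : sser := sdelta (fset0, xmonU i).

Lemma squo_smonM u v : [disjoint u.1 & v.1] ->
  u \in sdivs (smonM u v) /\ squo (smonM u v) u = v.
Proof.
move=> /fdisjointP duv; split.
  apply/sdvdP; split=> [|i]; first exact: fsubsetUl.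
  by rewrite xmonME leq_addr.
apply: smon_eqP => [|i]; last by rewrite xmonBE xmonME addKn.
apply/fsetP => i; rewrite in_fsetD in_fsetU.
case: (boolP (i \in u.1)) => //= /duv.
by move/negPf.
Qed.

Lemma sdeltaM u v : sdelta u * sdelta v =
  if [disjoint u.1 & v.1]%fset then (-1) ^+ sinv u.1 v.1 *: sdelta (smonM u v)
  else 0.
Proof.
apply: functional_extensionality_dep => w.
have -> : (sdelta u * sdelta v) w =
    if u \in sdivs w then (-1) ^+ sinv u.1 (squo w u).1 * (squo w u == v)%:R
    else 0.
  rewrite [LHS](_ : _ = sser_mul (sdelta u) (sdelta v) w) // /sser_mul /sdelta.
  case: ifP => [uw|uNw].
    rewrite (bigD1_seq u) ?fset_uniq //= eqxx mulr1 big1 ?addr0 // => t /negPf ->.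
    by rewrite mulr0 mul0r.
  rewrite big_seq big1 // => t tw; case: eqP => [tu|_].
    by rewrite -tu tw in uNw.
  by rewrite mulr0 mul0r.
case: (boolP [disjoint u.1 & v.1]%fset) => [duv|/negPf dNuv].
  rewrite [RHS](_ : _ = (-1) ^+ sinv u.1 v.1 * (w == smonM u v)%:R) //.
  have [uuv quv] := squo_smonM duv.
  case: (eqVneq w (smonM u v)) => [->|wN]; first by rewrite uuv quv eqxx.
  rewrite mulr0; case: ifP => // uw; case: eqP => [e|]; last by rewrite mulr0.
  have [_ e'] := squo_divs (smon_div w) uw.
  by rewrite -e e' eqxx in wN.
case: ifP => // uw; case: eqP => [e|]; last by rewrite mulr0.
by rewrite -e fdisjointDr_ in dNuv.
Qed.

Lemma theta_anticomm i j : theta i * theta j = - (theta j * theta i).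
Proof.
rewrite !sdeltaM /= fdisjoint_sym; case: ifP => [dij|]; last by rewrite oppr0.
have nij : i != j by move: dij; rewrite fdisjointX1 in_fset1 eq_sym.
rewrite /sinv !big_seq_fset1 -scaleNr /smonM /= fsetUC.
by case: ltngtP nij => //= _ _; rewrite ?expr0 ?expr1 ?opprK.
Qed.

Lemma theta_xvar_comm i j : theta i * xvar j = xvar j * theta i.
Proof.
rewrite !sdeltaM /= fdisjointX0 fdisjoint0X sinv0l sinv0r /smonM /= fsetUC.
by congr (_ *: sdelta (_, _)); apply/fsfunP => k; rewrite !xmonME addnC.
Qed.

Lemma xvar_comm i j : xvar i * xvar j = xvar j * xvar i.
Proof.
rewrite [LHS]sdeltaM [RHS]sdeltaM fdisjointX0 sinv0l /smonM.
by congr (_ *: sdelta (_, _)); apply/fsfunP => k; rewrite !xmonME addnC.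
Qed.

(* Superpartitions of (n|m), as pairs (Lambda^a, Lambda^s) where Lambda^s
   lists the nonzero symmetric entries only. *)
Definition is_spar (n m : nat) (L : seq nat * seq nat) : bool :=
  [&& size L.1 == m, sorted gtn L.1, sorted geq L.2, 0%N \notin L.2
    & (sumn L.1 + sumn L.2 == n)%N].

Record SPar (n m : nat) := MkSPar {
  spar_val :> seq nat * seq nat;
  spar_proof : is_spar n m spar_val }.

HB.instance Definition _ n m := [isSub for @spar_val n m].
HB.instance Definition _ n m := [Countable of SPar n m by <:].

Definition spa n m (L : SPar n m) : seq nat := (spar_val L).1.
Definition sps n m (L : SPar n m) : seq nat := (spar_val L).2.
Definition slen n m (L : SPar n m) : nat := (m + size (sps L))%N.

Lemma leq_sumn (s : seq nat) i : i \in s -> (i <= sumn s)%N.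
Proof.
elim: s => //= k s IHs; rewrite inE => /predU1P[->|/IHs]; first exact: leq_addr.
by move/leq_trans; apply; exact: leq_addl.
Qed.

Lemma leq_size_sumn (s : seq nat) : 0%N \notin s -> (size s <= sumn s)%N.
Proof.
elim: s => //= k s IHs; rewrite inE negb_or eq_sym -lt0n => /andP[k0 /IHs].
by move=> h; rewrite -add1n leq_add.
Qed.

(* SPar n m is finite: at most m, resp. n, entries, all at most n. *)
Definition spar_code n m (L : SPar n m) :
    option ({bseq m of 'I_n.+1} * {bseq n of 'I_n.+1}) :=
  match insub (map inord (spa L)), insub (map inord (sps L)) with
  | Some a, Some s => Some (a, s)
  | _, _ => None
  end.

Definition spar_decode n m
    (c : option ({bseq m of 'I_n.+1} * {bseq n of 'I_n.+1})) :
    option (SPar n m) :=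
  if c is Some (a, s) then insub (map val (val a), map val (val s)) else None.

Lemma spar_codeK n m : pcancel (@spar_code n m) (@spar_decode n m).
Proof.
case=> -[a s] H; have := H; rewrite /is_spar /=.
case/and5P => /eqP sza _ _ s0 /eqP sumE.
have inordK_ (t : seq nat) : (sumn t <= n)%N ->
    map val (map (inord : nat -> 'I_n.+1) t) = t.
  move=> tn; rewrite -map_comp map_id_in // => i it /=.
  by rewrite inordK // ltnS (leq_trans (leq_sumn it)).
have an : (sumn a <= n)%N by rewrite -sumE leq_addr.
have sn : (sumn s <= n)%N by rewrite -sumE leq_addl.
rewrite /spar_code /spa /sps /=.
case: insubP => [a' _ ea|]; last by rewrite size_map sza leqnn.
case: insubP => [s' _ es|].
  by rewrite /spar_decode ea es !inordK_ // insubT //=; congr Some; apply: val_inj.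
by rewrite size_map (leq_trans (leq_size_sumn s0) sn).
Qed.

HB.instance Definition _ n m : isFinite (SPar n m) :=
  PCanIsFinite (@spar_codeK n m).

(* C[Lambda]: the entries in nonincreasing order, marked [true] when circled,
   a circled entry coming before the uncircled ones of the same value. *)
Definition circled_le : rel (nat * bool) :=
  [rel p q | (q.1 < p.1)%N || ((p.1 == q.1) && (q.2 ==> p.2))].

Definition circled n m (L : SPar n m) : seq (nat * bool) :=
  sort circled_le ([seq (a, true) | a <- spa L] ++ [seq (b, false) | b <- sps L]).

(* D[Lambda]: row i, column j (from 0) *)
Definition dbox n m (L : SPar n m) (i j : nat) : bool :=
  (j < (nth (0, false) (circled L) i).1)%N.
Definition dcircle n m (L : SPar n m) (i j : nat) : bool :=
  nth (0%N, false) (circled L) i == (j, true).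

Definition is_conjugate n m (L L' : SPar n m) : Prop :=
  forall i j, dbox L' i j = dbox L j i /\ dcircle L' i j = dcircle L j i.

Lemma circled_le_total : total circled_le.
Proof.
move=> [a x] [b y] ; rewrite /circled_le /=; case: (ltngtP a b) => //= _.
by case: x; case: y.
Qed.

Lemma circled_le_trans : transitive circled_le.
Proof.
rewrite /circled_le => -[b y] [a x] [c z] /=.
case/orP=> [ab|/andP[/eqP eab xy]]; case/orP=> [bc|/andP[/eqP ebc yz]]; subst.
- by rewrite (ltn_trans bc ab).
- by rewrite ab.
- by rewrite bc.
- by rewrite eqxx orbC; move: x y z xy yz => [] [] [].
Qed.

Lemma circled_le_anti : antisymmetric circled_le.
Proof.
move=> [a x] [b y] ; rewrite /circled_le /=; case: (ltngtP a b) => //= ->.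
by case: x; case: y.
Qed.

Lemma circled_sorted n m (L : SPar n m) : sorted circled_le (circled L).
Proof. exact: sort_sorted circled_le_total _. Qed.

Lemma circled_perm n m (L : SPar n m) :
  perm_eq (circled L)
    ([seq (a, true) | a <- spa L] ++ [seq (b, false) | b <- sps L]).
Proof. by rewrite perm_sort. Qed.

Lemma mem_circled_true n m (L : SPar n m) i : ((i, true) \in circled L) = (i \in spa L).
Proof.
rewrite (perm_mem (circled_perm L)) mem_cat.
rewrite (mem_map (f := fun a => (a, true))) => [|? ? []//].
by case: (i \in spa L) => //=; apply/mapP => -[].
Qed.

Lemma sparP n m (L : SPar n m) :
  [/\ size (spa L) = m, sorted gtn (spa L), sorted geq (sps L), 0%N \notin sps L
    & (sumn (spa L) + sumn (sps L) = n)%N].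
Proof. by have /and5P[/eqP ? ? ? ? /eqP] := spar_proof L; split. Qed.

Lemma spa_uniq n m (L : SPar n m) : uniq (spa L).
Proof.
have [_ srt _ _ _] := sparP L.
apply: (sorted_uniq _ _ srt) => [y x z|x] /=; last by rewrite ltnn.
by move=> yx zy; exact: ltn_trans zy yx.
Qed.

Lemma spar_val_inj n m (L1 L2 : SPar n m) :
  spa L1 = spa L2 -> sps L1 = sps L2 -> L1 = L2.
Proof.
case: L1 L2 => [[a s] ?] [[b t] ?]; rewrite /spa /sps /= => ea es.
by apply: val_inj; rewrite /= ea es.
Qed.

(* number of boxes in column k of D[Lambda] *)
Definition col_len n m (L : SPar n m) (k : nat) : nat :=
  count (fun x => (k < x)%N) (spa L ++ sps L).

Lemma col_lenE n m (L : SPar n m) k :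
  col_len L k = count (fun p => (k < p.1)%N) (circled L).
Proof.
rewrite (seq.permP (circled_perm L)) /col_len !count_cat !count_map.
by congr (_ + _)%N; apply: eq_count.
Qed.

Lemma geq_trans_ : transitive geq.
Proof. by move=> y x z /= yx zy; exact: leq_trans zy yx. Qed.

Lemma count_gt_sorted (s : seq nat) i j :
  sorted geq s -> (j < count (fun x => (i < x)%N) s)%N = (i < nth 0 s j)%N.
Proof.
elim: s j => [|x s IHs] j /=; first by rewrite nth_nil.
rewrite (path_sortedE geq_trans_) => /andP[/allP xs /IHs{}IHs].
case: j => [|j] /=; last first.
  case ix: (i < x)%N; first by rewrite add1n ltnS IHs.
  rewrite add0n.
  have -> : count (fun x => i < x)%N s = 0%N.
    apply/eqP; rewrite -leqn0 leqNgt -has_count; apply/hasPn => y /xs /= yx.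
    by rewrite -leqNgt; apply: leq_trans yx _; rewrite leqNgt ix.
  rewrite ltn0; apply/esym/negbTE; rewrite -leqNgt.
  have [js|js] := ltnP j (size s); last by rewrite nth_default.
  apply: leq_trans (xs _ (mem_nth _ js)) _.
  by rewrite leqNgt ix.
case ix: (i < x)%N; first by rewrite add1n.
rewrite add0n; apply/negbTE; rewrite -leqNgt leqn0 -leqn0 leqNgt -has_count.
apply/hasPn => y /xs /= yx.
by rewrite -leqNgt; apply: leq_trans yx _; rewrite leqNgt ix.
Qed.

Lemma fst_circled_sorted s : sorted circled_le s -> sorted geq (map fst s).
Proof.
rewrite sorted_map; apply: sub_sorted => p q; rewrite /circled_le /relpre /=.
by case/orP => [/ltnW //|/andP[/eqP-> _]].
Qed.

Lemma dboxE n m (L : SPar n m) i j : dbox L j i = (j < col_len L i)%N.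
Proof.
rewrite /dbox col_lenE -(count_map fst (fun x => i < x)%N).
rewrite count_gt_sorted; last exact/fst_circled_sorted/circled_sorted.
have [js|js] := ltnP j (size (circled L)); first by rewrite (nth_map (0%N, false)).
by rewrite !nth_default ?size_map.
Qed.

Lemma nth_circled_true (s : seq (nat * bool)) i j :
  sorted circled_le s -> uniq [seq p <- s | p.2] ->
  (nth (0%N, false) s j == (i, true)) =
  ((i, true) \in s) && (count (fun p => (i < p.1)%N) s == j).
Proof.
elim: s j => [|p s IHs] j /=.
  by rewrite nth_nil => _ _; apply/negbTE/eqP.
rewrite (path_sortedE circled_le_trans) => /andP[/allP ps srt] us.
have {}IHs := IHs _ srt.
have us' : uniq [seq p <- s | p.2] by case: p.2 us => //= /andP[].
rewrite inE; case: (eqVneq p (i, true)) => [pE|pN]; last first.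
  rewrite /=.
  case is_: ((i, true) \in s); last first.
    case: j => [|j] /=; first by rewrite (negPf pN).
    by rewrite IHs // is_.
  have ip : (i < p.1)%N.
    have /= := ps _ is_; case/orP => // /andP[/eqP e p2].
    by case/eqP: pN; case: p e p2 {ps us} => ? [] //= ->.
  rewrite ip; case: j => [|j] /=; first by rewrite (negPf pN).
  by rewrite IHs // is_ add1n eqSS.
rewrite pE /= ltnn add0n.
have -> : count (fun p => i < p.1)%N s = 0%N.
  apply/eqP; rewrite -leqn0 leqNgt -has_count; apply/hasPn => q /ps.
  rewrite pE /circled_le /= -leqNgt => /orP[/ltnW //|/andP[/eqP e _]].
  by rewrite -e.
case: j => [|j] /=; first by rewrite eqxx.
rewrite IHs //; move: us; rewrite pE /= mem_filter /= => /andP[/negPf -> _].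
by [].
Qed.

Lemma circled_filter2 n m (L : SPar n m) :
  perm_eq [seq p <- circled L | p.2] [seq (a, true) | a <- spa L].
Proof.
apply: perm_trans (perm_filter _ (circled_perm L)) _.
rewrite filter_cat !filter_map.
by rewrite (eq_filter (a2 := predT)) // filter_predT (eq_filter (a2 := pred0)) // filter_pred0 cats0.
Qed.

Lemma circled_filter2C n m (L : SPar n m) :
  perm_eq [seq p <- circled L | ~~ p.2] [seq (a, false) | a <- sps L].
Proof.
apply: perm_trans (perm_filter _ (circled_perm L)) _.
rewrite filter_cat !filter_map.
by rewrite (eq_filter (a2 := pred0)) // filter_pred0 (eq_filter (a2 := predT)) // filter_predT.
Qed.

Lemma dcircleE n m (L : SPar n m) i j :
  dcircle L j i = (i \in spa L) && (col_len L i == j).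
Proof.
rewrite /dcircle nth_circled_true ?circled_sorted ?mem_circled_true ?col_lenE //.
rewrite (perm_uniq (circled_filter2 L)) map_inj_uniq ?spa_uniq //.
by move=> ? ? [].
Qed.

Lemma nth_filter_zero s i : sorted circled_le s ->
  nth (0%N, false) [seq p <- s | p != (0%N, false)] i = nth (0%N, false) s i.
Proof.
elim: s i => //= p s IHs i.
rewrite (path_sortedE circled_le_trans) => /andP[/allP ps srt].
case: eqP => [pE|_] /=; last by case: i => //= i; rewrite IHs.
have sz q : q \in s -> q = (0%N, false).
  by move=> /ps; rewrite pE; case: q => [[|b] []].
rewrite (_ : filter _ s = [::]) ?nth_nil; last first.
  by apply/eqP; rewrite -(negbK (_ == _)) -has_filter; apply/hasPn => q /sz ->.
case: i => [|i] /=; first by rewrite pE.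
have [js|js] := ltnP i (size s); last by rewrite nth_default.
by rewrite (sz _ (mem_nth _ js)).
Qed.

Lemma sum_ltn_iota x N : (x <= N)%N -> (\sum_(k <- iota 0 N) (k < x) = x)%N.
Proof.
move=> xN; rewrite -(subnKC xN) iotaD big_cat /= big_seq [X in (_ + X)%N]big_seq.
rewrite (eq_bigr (fun=> 1%N)) => [|k]; last by rewrite mem_iota => /andP[_ ->].
rewrite [X in (_ + X)%N]big1 => [|k].
  by rewrite -big_seq sum1_size size_iota addn0.
by rewrite mem_iota => /andP[xk _]; rewrite ltnNge xk.
Qed.

Section ConjugateExists.
Variables (n m : nat) (L : SPar n m).

Let conj_a := rev [seq col_len L k | k <- spa L].
Let conj_s :=
  [seq c <- [seq col_len L k | k <- iota 0 n.+1 & k \notin spa L] | c != 0%N].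

Let entry_le k : k \in spa L ++ sps L -> (k <= n)%N.
Proof.
have [_ _ _ _ sumE] := sparP L.
by move/leq_sumn; rewrite sumn_cat sumE.
Qed.

Let col_len_mono k k' : (k <= k')%N -> (col_len L k' <= col_len L k)%N.
Proof. by move=> kk; apply: sub_count => x; exact: leq_ltn_trans. Qed.

Let col_len_strict k k' : k' \in spa L -> (k < k')%N ->
  (col_len L k' < col_len L k)%N.
Proof.
move=> k'a kk; rewrite /col_len.
have : k' \in spa L ++ sps L by rewrite mem_cat k'a.
elim: (_ ++ _) => //= x s IHs; rewrite inE => /predU1P[<-|/IHs{}IHs].
  rewrite ltnn kk add0n add1n ltnS; apply: sub_count => y; exact: ltn_trans.
rewrite -addnS; apply: leq_add => //.
by case k'x: (k' < x)%N => //; rewrite (ltn_trans kk k'x).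
Qed.

Let col_len_big k : (n < k)%N -> col_len L k = 0%N.
Proof.
move=> nk; apply/eqP; rewrite -leqn0 leqNgt -has_count; apply/hasPn => x /entry_le.
by rewrite -leqNgt => /leq_trans; apply; exact: ltnW.
Qed.

Let sum_col_len : (\sum_(k <- iota 0 n.+1) col_len L k = n)%N.
Proof.
have [_ _ _ _ sumE] := sparP L; rewrite -[RHS]sumE -sumn_cat /col_len.
move: entry_le; elim: (_ ++ _) => [|x s IHs] le_n /=; first by rewrite big1.
rewrite big_split /= IHs => [|k ks]; last by rewrite le_n // inE ks orbT.
congr (_ + _)%N; apply: (@sum_ltn_iota x n.+1).
by rewrite ltnW // ltnS le_n // inE eqxx.
Qed.

Let spa_iota : perm_eq [seq k <- iota 0 n.+1 | k \in spa L] (spa L).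
Proof.
apply: uniq_perm; rewrite ?filter_uniq ?iota_uniq ?spa_uniq // => k.
rewrite mem_filter mem_iota /= add0n ltnS; case ka: (k \in spa L) => //=.
by rewrite entry_le // mem_cat ka.
Qed.

Let conjP : is_spar n m (conj_a, conj_s).
Proof.
have [sza srta _ _ _] := sparP L.
apply/and5P; split.
- by rewrite size_rev size_map sza.
- rewrite rev_sorted sorted_map.
  apply: (sub_in_sorted (P := mem (spa L)) _ _ srta); last exact/allP.
  by move=> k k' ka k'a /=; exact: col_len_strict.
- apply: sorted_filter; first exact: geq_trans_.
  rewrite sorted_map; apply: sub_sorted (sorted_filter ltn_trans _ (iota_ltn_sorted 0 _)).
  by move=> k k' /ltnW; exact: col_len_mono.
- by rewrite mem_filter.
- have ea : (sumn conj_a = \sum_(k <- iota 0 n.+1 | k \in spa L) col_len L k)%N.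
    by rewrite /conj_a sumn_rev sumnE big_map -(perm_big _ spa_iota) big_filter.
  have es : (sumn conj_s = \sum_(k <- iota 0 n.+1 | k \notin spa L) col_len L k)%N.
    rewrite /conj_s sumnE big_filter big_map big_filter_cond big_mkcondr.
    by apply: eq_bigr => k _; case: eqP.
  by rewrite [X in (X + _)%N]ea [X in (_ + X)%N]es -[X in _ == X]sum_col_len
             [X in _ == X](bigID (mem (spa L))).
Qed.

Let L' := MkSPar conjP.
Let C' := [seq (col_len L k, k \in spa L) | k <- iota 0 n.+1].

Let C'_sorted : sorted circled_le C'.
Proof.
rewrite sorted_map; apply: sub_sorted (iota_ltn_sorted 0 _) => k k' kk.
rewrite /circled_le /relpre /=; have := col_len_mono (ltnW kk).
rewrite leq_eqVlt => /predU1P[e|->] //; rewrite e ltnn eqxx /=.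
apply/implyP => k'a; have := col_len_strict k'a kk.
by rewrite e ltnn.
Qed.

Let circled_conj : circled L' = [seq p <- C' | p != (0%N, false)].
Proof.
apply: (sorted_eq circled_le_trans circled_le_anti).
- exact: circled_sorted.
- exact: sorted_filter circled_le_trans _ _ C'_sorted.
apply: perm_trans (circled_perm L') _.
rewrite perm_sym -(perm_filterC (fun p => p.2)).
have -> : spa L' = conj_a by [].
have -> : sps L' = conj_s by [].
apply: perm_cat.
  rewrite -filter_predI /C' filter_map.
  rewrite (eq_filter (a2 := fun k => k \in spa L)); last first.
    by move=> k /=; case: (k \in spa L) => //=; rewrite xpair_eqE andbF.
  rewrite /conj_a map_rev perm_sym perm_rev -map_comp perm_sym.
  rewrite (eq_in_map _ (fun k => (col_len L k, true)) _).1; last first.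
    by move=> k; rewrite mem_filter => /andP[->].
  exact: perm_map.
rewrite -filter_predI /C' filter_map /conj_s filter_map -map_comp -filter_predI.
rewrite (@eq_filter _ _ (predI (fun k => col_len L k != 0%N) (fun k => k \notin spa L))).
  rewrite (eq_in_map _ (fun k => (col_len L k, false)) _).1 //.
  by move=> k; rewrite mem_filter => /andP[/andP[_ /negPf ->]].
move=> k /=; rewrite xpair_eqE andbC; case: (k \in spa L) => //=.
  by rewrite !andbF.
by rewrite eqxx !andbT.
Qed.

Let nth_conj i : nth (0%N, false) (circled L') i = (col_len L i, i \in spa L).
Proof.
rewrite circled_conj nth_filter_zero //.
have [ni|ni] := ltnP i n.+1.
  by rewrite (nth_map 0%N) ?size_iota // nth_iota // add0n.
rewrite nth_default ?size_map ?size_iota // col_len_big //.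
case ia: (i \in spa L) => //.
by move: ni; rewrite ltnNge entry_le // mem_cat ia.
Qed.

Lemma conjugate_exists : exists L0 : SPar n m, is_conjugate L L0.
Proof.
exists L' => i j; rewrite (dboxE L) (dcircleE L); split.
  by rewrite /dbox nth_conj.
by rewrite /dcircle nth_conj xpair_eqE andbC eqb_id.
Qed.

End ConjugateExists.

Lemma circled_nz n m (L : SPar n m) : (0%N, false) \notin circled L.
Proof.
have [_ _ _ s0 _] := sparP L.
rewrite (perm_mem (circled_perm L)) mem_cat negb_or; apply/andP; split.
  by apply/mapP => -[].
by apply/mapP => -[b bs [b0]]; rewrite b0 bs in s0.
Qed.

Lemma nth_dflt_inj (T : eqType) (z : T) (s t : seq T) :
  z \notin s -> z \notin t -> nth z s =1 nth z t -> s = t.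
Proof.
elim: s t => [|x s IHs] [|y t] //=.
- by rewrite inE negb_or => _ /andP[/eqP zy _] /(_ 0%N) /=.
- by rewrite inE negb_or => /andP[/eqP zy _] _ /(_ 0%N) /= /esym.
rewrite !inE !negb_or => /andP[_ zs] /andP[_ zt] e.
by rewrite (e 0%N : x = y) (IHs t) // => i; exact: (e i.+1).
Qed.

Lemma circled_inj n m (L1 L2 : SPar n m) : circled L1 = circled L2 -> L1 = L2.
Proof.
move=> e; have [_ a1 s1 _ _] := sparP L1; have [_ a2 s2 _ _] := sparP L2.
have gtn_trans_ : transitive gtn by move=> y x z /= yx zy; exact: ltn_trans zy yx.
apply: spar_val_inj.
  apply: (sorted_eq gtn_trans_ _ a1 a2).
    by move=> x y /andP[/= /ltnW xy /ltnW yx]; apply/eqP; rewrite eqn_leq yx xy.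
  apply: (@perm_map_inj _ _ (fun a => (a, true))); first by move=> ? ? [].
  apply: perm_trans (circled_filter2 L2); rewrite -e perm_sym.
  exact: circled_filter2.
apply: (sorted_eq geq_trans_ _ s1 s2).
  by move=> x y /andP[/= xy yx]; apply/eqP; rewrite eqn_leq yx xy.
apply: (@perm_map_inj _ _ (fun a => (a, false))); first by move=> ? ? [].
apply: perm_trans (circled_filter2C L2); rewrite -e perm_sym.
exact: circled_filter2C.
Qed.

Lemma conjugate_uniq n m (L L1 L2 : SPar n m) :
  is_conjugate L L1 -> is_conjugate L L2 -> L1 = L2.
Proof.
move=> c1 c2; apply: circled_inj; apply: nth_dflt_inj (circled_nz _) (circled_nz _) _.
move=> i; set p := nth _ _ _; set q := nth _ _ _.
have pq1 : p.1 = q.1.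
  have le_lt (a b : nat) : (forall j, (j < a) = (j < b))%N -> (a <= b)%N.
    by move=> h; rewrite leqNgt h ltnn.
  have h j : (j < p.1 = (j < q.1))%N.
    by have [] := c1 i j; have [] := c2 i j; rewrite /dbox => -> _ -> _.
  by apply/eqP; rewrite eqn_leq !le_lt.
have h j : (p == (j, true)) = (q == (j, true)).
  by have [_] := c1 i j; have [_] := c2 i j; rewrite /dcircle => -> ->.
move: (h p.1) pq1; rewrite {1 3}(surjective_pairing p) {1 3}(surjective_pairing q).
case: p q {h} => [a x] [b y] /= + ab; rewrite ab !xpair_eqE !eqxx /=.
by case: x y => [] [].
Qed.

Lemma conjugateP n m (L : SPar n m) : exists! L' : SPar n m, is_conjugate L L'.
Proof.
have [L' cL] := conjugate_exists L; exists L'; split=> // L''.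
exact: conjugate_uniq.
Qed.

(* Bruhat order of 'S_N: u is below v when v is reached from u by right
   multiplications by transpositions, each increasing the length. *)
Definition perm_len N (w : 'S_N) : nat :=
  #|[set p : 'I_N * 'I_N | (p.1 < p.2)%N && (w p.2 < w p.1)%N]|.
Definition bruhat_step N : rel 'S_N := fun u v =>
  [exists i, exists j, v == (u * tperm i j)%g] && (perm_len u < perm_len v)%N.
Definition bruhat N : rel 'S_N := connect (@bruhat_step N).

(* Compositions with N entries; w lambda has w(i)-th entry lambda_i. *)
Definition comp_act N (w : 'S_N) (l : N.-tuple nat) : N.-tuple nat :=
  [tuple tnth l ((w^-1)%g i) | i < N].
Definition comp_plus N (l : N.-tuple nat) : N.-tuple nat := [tuple of sort geq l].
Definition comp_perm N (l : N.-tuple nat) : 'S_N :=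
  [arg min_(w < 1%g | l == comp_act w (comp_plus l)) perm_len w]%N.

Definition dominance N (mu la : N.-tuple nat) : bool :=
  [forall k : 'I_N.+1, (sumn (take k mu) <= sumn (take k la))%N].

Definition comp_le N (mu la : N.-tuple nat) : bool :=
  ((comp_plus mu != comp_plus la) && dominance (comp_plus mu) (comp_plus la))
  || ((comp_plus mu == comp_plus la) && bruhat (comp_perm la) (comp_perm mu)).

(* Lambda^c, cut or padded with zeros to N entries *)
Definition spar_comp N n m (L : SPar n m) : N.-tuple nat :=
  [tuple nth 0%N (spa L ++ sps L) i | i < N].

Definition spar_le n m (O L : SPar n m) : bool :=
  let N := maxn (slen O) (slen L) in comp_le (spar_comp N O) (spar_comp N L).
Definition spar_lt n m (O L : SPar n m) : bool := (O != L) && spar_le O L.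

(* F N is a superpolynomial in the first N variables, for N >= N0. When the
   coefficient of each monomial u in F N is the same for all N >= N0 such that
   u only involves the first N variables, this is the stable formal sum. *)
Definition sbound (u : smon) : nat :=
  (\max_(i <- u.1 `|` finsupp u.2) i.+1)%N.
Definition stable (N0 : nat) (F : nat -> sser) : sser :=
  fun u => F (maxn N0 (sbound u)) u.

Definition nfact N n m (L : SPar n m) : nat :=
  let s := drop m (spar_comp N L) in
  (\prod_(i <- undup s) (count_mem i s)`!)%N.

(* for N >= slen L *)
Definition mono_fin N n m (L : SPar n m) : sser :=
  (nfact N L)%:R^-1 *:
  \sum_(s : 'S_N) ((\prod_(i < N | (i < m)%N) theta (s i)) *
                   \prod_(i < N) xvar (s i) ^+ tnth (spar_comp N L) i).
Definition mono n m (L : SPar n m) : sser :=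
  stable (slen L) (fun N => mono_fin N L).

Definition elem_fin (n N : nat) : sser :=
  \sum_(J : {set 'I_N} | #|J| == n) \prod_(j in J) xvar j.
Definition telem_fin (n N : nat) : sser :=
  \sum_(i < N) theta i *
    \sum_(J : {set 'I_N} | (#|J| == n) && (i \notin J)) \prod_(j in J) xvar j.
Definition elem (n : nat) : sser := stable 0 (elem_fin n).
Definition telem (n : nat) : sser := stable 0 (telem_fin n).

Definition elem_spar n m (L : SPar n m) : sser :=
  (\prod_(k <- spa L) telem k) * \prod_(k <- sps L) elem k.

(* The Z-span of the m_Lambda *)
Definition symsuper (n m : nat) (f : sser) : Prop :=
  exists c : SPar n m -> int, f = \sum_L mono L *~ c L.

(* The family b is a basis of the submodule P of the Z-module V. *)
Definition is_Zbasis (V : zmodType) (P : V -> Prop) (I : finType) (b : I -> V) :=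
  [/\ forall i, P (b i),
      forall c : I -> int, \sum_i b i *~ c i = 0 -> forall i, c i = 0
    & forall f, P f -> exists c : I -> int, f = \sum_i b i *~ c i].

(* Main.v *)
(* The coefficient of [theta_0 .. theta_(m-1) x^Omega] in a product of elementary
   superfunctions counts, up to sign, 0-1 matrices with row sums [Lambda] and
   column sums [Omega], where each fermionic row carries a circle on one of its
   zeros and every column [i < m] carries exactly one circle. Comparing the
   [k] largest columns with the row sums gives the dominance of [Lambda'] over
   [Omega]. In the equality case the matrix is forced to be a Ferrers diagram
   up to a permutation of the columns, the circles force
   [Omega_i <= Lambda'_i] for [i < m], and this entrywise comparison is turned
   into a chain of transpositions in the Bruhat order; if [Omega = Lambda'] the
   circles are forced too, so that the coefficient is 1. Since a symmetric
   superseries is determined by its coefficients at the monomials attached to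
   superpartitions, this is the expansion on the [mono], and the basis property
   follows by unitriangularity. *)
From HB Require Import structures.
From mathcomp Require Import all_boot all_order all_algebra all_fingroup finmap zify.
From mathcomp.classical Require Import boolp.
Require Import Defs.
Set Implicit Arguments.
Unset Strict Implicit.
Unset Printing Implicit Defensive.

(** * Bruhat order on compositions *)

(** The fermionic factors come with increasing indices because [col_len] strictly decreases along
    the parts of Lambda^a: factor number r then has its circle in column r of the leading matrix,
    the thetas appear as theta_0 ... theta_(m-1), and the leading coefficient is 1 without any sign.
    For the other coefficients only integrality and the existence of a matrix matter, so their signs
    are never computed. The columns of Omega^c and Lambda'^c are sorted by different permutations,
    so a matrix is read through [comp_perm] of its own column sums, where it becomes a Ferrers
    diagram in the equality case. The circle of row r then sits at a sorted position at least the
    length of the row, in a column no longer than Lambda'_r. The circles permute the first m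
    columns, and a pigeonhole argument yields the entrywise comparison. The order pads a pair to a
    length depending on that pair, whereas the inductions use one integer rank computed with n + m
    entries. The estimates on matrices are therefore proved for every sufficiently large N. *)

Definition inversions N (g : 'I_N -> nat) : {set 'I_N * 'I_N} :=
  [set p : 'I_N * 'I_N | (p.1 < p.2) && (g p.2 < g p.1)].

(** The action on compositions reads [w^-1], so exchanging two positions composes [w^-1] with a
    transposition on the side where inversions are easy to compare. The pair (p, q) corresponds to
    (w q, w p). *)
Lemma perm_len_inversions N (w : 'S_N) :
  perm_len w = #|inversions (fun i => (w^-1)%g i)|.
Proof.
rewrite /perm_len -(card_imset _ (f := fun p : 'I_N * 'I_N => (w p.2, w p.1))).
  apply: eq_card => -[P Q]; rewrite !inE /=; apply/imsetP/idP.
    by case=> -[p q]; rewrite inE /= => /andP[pq wqp] [-> ->]; rewrite !permK wqp.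
  move=> /andP[PQ wQP]; exists ((w^-1)%g Q, (w^-1)%g P); rewrite ?inE /= !permKV //.
  by rewrite wQP.
by move=> [p q] [p' q'] [/perm_inj -> /perm_inj ->].
Qed.

(** The map [phi] applies the transposition to both members of a pair when this keeps them in
    increasing order and fixes the pair otherwise. It injects the old inversions into the new ones
    and misses (i, j), which it fixes and which is a new inversion only. *)
Lemma card_inversions_tperm N (g : 'I_N -> nat) (i j : 'I_N) :
  i < j -> g i < g j -> #|inversions g| < #|inversions (g \o tperm i j)|.
Proof.
move=> ij gij; set t := tperm i j.
pose phi (p : 'I_N * 'I_N) := if t p.1 < t p.2 then (t p.1, t p.2) else p.
have phiK : {in [set p : 'I_N * 'I_N | p.1 < p.2], involutive phi}.
  move=> [P Q]; rewrite inE /= => PQ; rewrite /phi /=.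
  by case h: (t P < t Q); rewrite /= ?tpermK ?PQ ?h.
have phi_inj : {in inversions g &, injective phi}.
  move=> p q; rewrite !inE => /andP[p12 _] /andP[q12 _] e.
  by rewrite -[p]phiK ?inE // e phiK ?inE.
rewrite -(card_in_imset phi_inj); apply: proper_card; apply/properP; split.
  apply/subsetP => q /imsetP[[P Q] + ->{q}]; rewrite inE /= => /andP[PQ gQP].
  rewrite /phi /=; case: ifPn => [tPQ|]; first by rewrite inE /= tPQ !tpermK.
  rewrite inE /= PQ /= /t.
  case: (tpermP i j P) => [eP|eP|nPi nPj]; case: (tpermP i j Q) => [eQ|eQ|nQi nQj];
    rewrite ?eP ?eQ in PQ gQP *; lia.
exists (i, j); first by rewrite inE /= ij /t tpermL tpermR.
apply/imsetP => -[[P Q]]; rewrite inE /= => /andP[PQ gQP] e.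
have := phiK (P, Q); rewrite inE /= -e => /(_ PQ).
rewrite /phi /= /t tpermL tpermR; case: ifP => [|_ [eP eQ]]; first lia.
by rewrite -eP -eQ in gQP; lia.
Qed.

Section Compositions.
Variable N : nat.
Implicit Types (l mu : N.-tuple nat) (w : 'S_N).

(** Characterises the representative of minimal length without mentioning length: equal entries keep
    their relative order. *)
Definition tie_monotone l w :=
  forall P Q : 'I_N, P < Q -> tnth l P = tnth l Q -> (w^-1)%g P < (w^-1)%g Q.

Lemma comp_plus_anti l (i j : 'I_N) : i <= j ->
  tnth (comp_plus l) j <= tnth (comp_plus l) i.
Proof.
move=> ij; rewrite !(tnth_nth 0) /=.
have srt : sorted geq (sort geq l) by apply: sort_sorted => x y /=; exact: leq_total.
apply: (sorted_leq_nth geq_trans_ (leqnn : reflexive geq) 0 srt) => //.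
  by rewrite inE size_sort size_tuple.
by rewrite inE size_sort size_tuple.
Qed.

Lemma comp_act_ex l : exists w, l == comp_act w (comp_plus l).
Proof.
have /tuple_permP[p e] : perm_eq l (comp_plus l) by rewrite perm_sym perm_sort.
exists (p^-1)%g; apply/eqP/val_inj; apply: etrans e _; congr val.
by apply: eq_from_tnth => i; rewrite !tnth_mktuple invgK.
Qed.

Lemma comp_permP l :
  l = comp_act (comp_perm l) (comp_plus l) /\
  (forall w, l = comp_act w (comp_plus l) -> perm_len (comp_perm l) <= perm_len w).
Proof.
have [w1 w1P] := comp_act_ex l.
pose P w := l == comp_act w (comp_plus l).
have [w Pw min_w] : exists2 w, P w & forall v, P v -> perm_len w <= perm_len v.
  case: (@arg_minnP _ w1 P (@perm_len N) w1P) => w Pw min_w; by exists w.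
(* The default [1%g] may fail the predicate, so the search inside [arg_min] is opened and the
   minimum [w] found from [w1] shows that it succeeds. *)
rewrite /comp_perm /arg_min /extremum; case: pickP => [v /andP[/eqP Pv]|/(_ w)] /=.
  by move=> /forallP min_v; split=> // u uP; apply/(implyP (min_v u))/eqP.
rewrite [l == _]Pw /= => /negP[]; apply/forallP => v; apply/implyP; exact: min_w.
Qed.

Lemma comp_perm_tnth l i : tnth l (comp_perm l i) = tnth (comp_plus l) i.
Proof.
have [e _] := comp_permP l.
by rewrite {1}e tnth_mktuple permK.
Qed.

(** If two equal entries were exchanged by the minimal representative, multiplying by their
    transposition would give a strictly shorter representative of the same composition. *)
Lemma comp_perm_tie l : tie_monotone l (comp_perm l).
Proof.
have [e min_w] := comp_permP l; move: e min_w; set w := comp_perm l => e min_w.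
move=> P Q PQ lPQ; case: ltngtP => // [wQP|/val_inj/perm_inj ePQ]; last first.
  by rewrite ePQ ltnn in PQ.
suff : perm_len (w * tperm P Q) < perm_len w.
  rewrite ltnNge min_w //; apply: eq_from_tnth => k.
  rewrite tnth_mktuple invMg permM tpermV.
  have -> : tnth l k = tnth l (tperm P Q k) by case: tpermP => [->|->|].
  by rewrite {1}e tnth_mktuple.
rewrite !perm_len_inversions.
apply: leq_trans (@card_inversions_tperm _ _ P Q PQ _) _ => /=.
  by rewrite invMg !permM tpermV tpermL tpermR.
apply: eq_leq; congr #|pred_of_set (inversions _)|.
by apply: funext => k /=; rewrite invMg !permM tpermV tpermK.
Qed.

(** The order of the values of [v^-1] is dictated by [l]: larger entries first, ties from left to
    right. The value of [v^-1] at P is then the number of positions that precede P. *)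
Lemma tie_monotone_uniq l w w' :
  l = comp_act w (comp_plus l) -> tie_monotone l w ->
  l = comp_act w' (comp_plus l) -> tie_monotone l w' -> w = w'.
Proof.
have lt_invE v : l = comp_act v (comp_plus l) -> tie_monotone l v ->
    forall P Q, ((v^-1)%g P < (v^-1)%g Q) =
      (tnth l Q < tnth l P) || ((tnth l P == tnth l Q) && (P < Q)).
  move=> e tie P Q.
  have lE k : tnth l k = tnth (comp_plus l) ((v^-1)%g k) by rewrite {1}e tnth_mktuple.
  have mono P1 Q1 : tnth l P1 < tnth l Q1 -> (v^-1)%g Q1 < (v^-1)%g P1.
    by rewrite ltnNge => h; rewrite ltnNge; apply: contra h; rewrite !lE; apply: comp_plus_anti.
  case: (ltngtP (tnth l Q)) => /= [/mono->//|/mono/ltnW|lPQ].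
    by rewrite leqNgt => /negPf.
  case: (ltngtP P Q) => [/tie->//|/tie h|/val_inj ->]; last by rewrite ltnn.
  by have /ltnW := h lPQ; rewrite leqNgt => /negPf.
have cardE (v : 'S_N) (P : 'I_N) : #|[set Q | (v^-1)%g Q < (v^-1)%g P]| = (v^-1)%g P :> nat.
  rewrite (_ : [set _ | _] = (v^-1)%g @^-1: [set k : 'I_N | k < (v^-1)%g P]).
    rewrite on_card_preimset; last by apply: onW_bij; exact: (injF_bij perm_inj).
    rewrite -sum1_card; under eq_bigl do rewrite inE.
    by rewrite (big_ord_narrow (ltnW (ltn_ord _))) sum1_card card_ord.
  by apply/setP => Q; rewrite !inE.
move=> e tie e' tie'; apply: invg_inj; apply/permP => P; apply: val_inj => /=.
apply: etrans (esym (cardE w P)) (etrans _ (cardE w' P)).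
apply: eq_card => Q; rewrite !inE.
by rewrite (lt_invE w) // (lt_invE w').
Qed.

Definition comp_swap (i j : 'I_N) l : N.-tuple nat :=
  [tuple tnth l (tperm i j k) | k < N].

Lemma comp_swap_perm i j l : perm_eq (comp_swap i j l) l.
Proof. by apply/tuple_permP; exists (tperm i j). Qed.

Lemma comp_plus_eq l mu : perm_eq l mu -> comp_plus l = comp_plus mu.
Proof.
move=> e; apply: val_inj; apply/perm_sortP => //.
- by move=> x y /=; exact: leq_total.
- exact: geq_trans_.
- by move=> x y /andP[/= xy yx]; apply/eqP; rewrite eqn_leq xy yx.
Qed.

(* When no entry strictly between positions [i] and [j] equals one of the two
   swapped values, the minimal representative is multiplied by the
   transposition itself. *)
Lemma bruhat_swap_tight l (i j : 'I_N) :
  i < j -> tnth l j < tnth l i ->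
  (forall k : 'I_N, i < k < j -> tnth l k != tnth l i /\ tnth l k != tnth l j) ->
  bruhat (comp_perm l) (comp_perm (comp_swap i j l)).
Proof.
move=> ij lji btw; set w := comp_perm l.
have [e _] := comp_permP l; rewrite -/w in e.
have plusE : comp_plus (comp_swap i j l) = comp_plus l.
  exact/comp_plus_eq/comp_swap_perm.
have invE k : ((w * tperm i j)^-1)%g k = (w^-1)%g (tperm i j k).
  by rewrite invMg permM tpermV.
have -> : comp_perm (comp_swap i j l) = (w * tperm i j)%g.
  apply: (@tie_monotone_uniq (comp_swap i j l)); last 1 first.
  - move=> P Q PQ; rewrite !tnth_mktuple !invE => lPQ; apply: comp_perm_tie => //.
    have out k : tnth l k = tnth l i \/ tnth l k = tnth l j -> k <= i \/ j <= k.
      move=> lk; case: (leqP k i) => [|ik]; first by left.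
      case: (leqP j k) => [|kj]; first by right.
      by have [/eqP ? /eqP ?] := btw k (introT andP (conj ik kj)); case: lk.
    have nat_neq (p q : 'I_N) : p <> q -> p <> q :> nat by move=> ? /val_inj.
    clear btw; case: (tpermP i j P) lPQ => [eP|eP|/nat_neq nPi /nat_neq nPj];
      case: (tpermP i j Q) => [eQ|eQ|/nat_neq nQi /nat_neq nQj] lPQ;
      rewrite ?eP ?eQ in PQ lPQ *; try lia.
    + by have := out _ (or_intror (esym lPQ)); lia.
    + by have := out _ (or_introl lPQ); lia.
  - by case: (comp_permP (comp_swap i j l)).
  - exact: comp_perm_tie.
  - apply: eq_from_tnth => k; rewrite !tnth_mktuple plusE invE.
    by rewrite {1}e tnth_mktuple.
apply: connect1; apply/andP; split.
  by apply/existsP; exists i; apply/existsP; exists j.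
rewrite !perm_len_inversions.
apply: leq_trans (@card_inversions_tperm _ _ i j ij _) _ => /=.
  have lE k : tnth l k = tnth (comp_plus l) ((w^-1)%g k) by rewrite {1}e tnth_mktuple.
  by rewrite ltnNge; apply/negP => /(@comp_plus_anti l); rewrite -!lE leqNgt lji.
apply: eq_leq; congr #|pred_of_set (inversions _)|.
by apply: funext => k /=; rewrite invE.
Qed.

(** Induction on the distance. If an entry at k between i and j equals one of the two exchanged
    values, the swap factors into swaps on the two shorter intervals, each of which still moves a
    larger value to the right. *)
Lemma bruhat_swap l (i j : 'I_N) :
  i < j -> tnth l j < tnth l i ->
  bruhat (comp_perm l) (comp_perm (comp_swap i j l)).
Proof.
have [d] := ubnP (j - i); elim: d l i j => // d IHd l i j dP ij lji.
have [/existsP[k /andP[/andP[ik kj] lk]]|] :=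
  boolP [exists k : 'I_N, (i < k < j) && ((tnth l k == tnth l i) || (tnth l k == tnth l j))]; last first.
  move=> h; apply: bruhat_swap_tight => // k ikj.
  by move: h => /existsPn /(_ k); rewrite ikj negb_or => /andP.
have [nij nik nkj] : [/\ i != j, i != k & k != j].
  by split; apply/eqP => e; subst; rewrite ltnn in ij ik kj.
have [e|e] := orP lk; move/eqP in e.
  have -> : comp_swap i j l = comp_swap i k (comp_swap k j l).
    apply: eq_from_tnth => p; rewrite !tnth_mktuple.
    have [->|pi] := eqVneq p i.
      by rewrite !tpermL.
    have [->|pj] := eqVneq p j.
      by rewrite tpermR (@tpermD _ i k j) ?tpermR // eq_sym.
    have [->|pk] := eqVneq p k.
      by rewrite tpermR !tpermD // eq_sym.
    by rewrite !tpermD // eq_sym.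
  have dkj : j - k < d by lia.
  have dik : k - i < d by lia.
  apply: (connect_trans (IHd l k j dkj kj _)); first by rewrite e.
  by apply: (IHd _ i k dik ik); rewrite !tnth_mktuple tpermL tpermD // eq_sym.
have -> : comp_swap i j l = comp_swap k j (comp_swap i k l).
  apply: eq_from_tnth => p; rewrite !tnth_mktuple.
  have [->|pi] := eqVneq p i.
    by rewrite tpermL (@tpermD _ k j i) ?tpermL // eq_sym.
  have [->|pj] := eqVneq p j.
    by rewrite !tpermR.
  have [->|pk] := eqVneq p k.
    by rewrite tpermL !tpermD // eq_sym.
  by rewrite !tpermD // eq_sym.
have dkj : j - k < d by lia.
have dik : k - i < d by lia.
apply: (connect_trans (IHd l i k dik ik _)); first by rewrite e.
by apply: (IHd _ k j dkj kj); rewrite !tnth_mktuple tpermR tpermD // eq_sym.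
Qed.

Definition is_superseq (m : nat) l :=
  (forall p q : 'I_N, p < q -> q < m -> tnth l q < tnth l p) /\
  (forall p q : 'I_N, m <= p -> p <= q -> tnth l q <= tnth l p).

Lemma superseq_eq m l mu : is_superseq m l -> is_superseq m mu -> perm_eq l mu ->
  (forall p : 'I_N, p < m -> tnth l p = tnth mu p) -> l = mu.
Proof.
move=> [_ sl] [_ smu] lmu eqa.
have tE : take m l = take m mu.
  apply: (@eq_from_nth _ 0); rewrite !size_take !size_tuple // => k km.
  have kN : k < N by move: km; case: ifP => // *; lia.
  have km' : k < m by move: km; case: ifP => // *; lia.
  by rewrite !nth_take // -[k]/(val (Ordinal kN)) -!tnth_nth eqa.
have srt_drop (r : N.-tuple nat) :
    (forall p q : 'I_N, m <= p -> p <= q -> tnth r q <= tnth r p) -> sorted geq (drop m r).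
  move=> sr; apply/(sortedP 0) => k; rewrite size_drop size_tuple => kN.
  rewrite !nth_drop /=.
  have kN1 : m + k < N by lia.
  have kN2 : m + k.+1 < N by lia.
  rewrite -[m + k]/(val (Ordinal kN1)) -[m + k.+1]/(val (Ordinal kN2)) -!tnth_nth.
  by apply: sr => /=; lia.
apply: val_inj; rewrite /= -[tval l](cat_take_drop m) -[tval mu](cat_take_drop m) tE.
congr (_ ++ _); apply: (sorted_eq geq_trans_); rewrite ?srt_drop //.
  by move=> x y /andP[/= xy yx]; apply/eqP; rewrite eqn_leq yx xy.
by rewrite -(perm_cat2l (take m l)) cat_take_drop tE cat_take_drop.
Qed.

(* Induct on the total gap: take the last [i] at which [l] exceeds [mu], and
   exchange [l_i] with the first smaller entry of the symmetric part. *)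
Lemma bruhat_superseq m l mu :
  is_superseq m l -> is_superseq m mu -> perm_eq l mu ->
  (forall p : 'I_N, p < m -> tnth mu p <= tnth l p) ->
  bruhat (comp_perm l) (comp_perm mu).
Proof.
have [d] := ubnP (\sum_(p < N | p < m) (tnth l p - tnth mu p)).
elim: d l => // d IHd l dP Sl Smu lmu le_mu.
have [/existsP[i0 i0P]|/existsPn h] := boolP [exists i : 'I_N, (i < m) && (tnth mu i < tnth l i)];
    last first.
  rewrite (_ : l = mu); first exact: connect0.
  apply: (superseq_eq Sl Smu lmu) => p pm; have := h p; have := le_mu _ pm.
  by rewrite pm /= => ?; lia.
have [i /andP[im mui_lt] max_i] := @arg_maxnP _ i0
  (fun i : 'I_N => (i < m) && (tnth mu i < tnth l i)) val i0P.
have [k lk] : exists k, tnth mu i = tnth l k.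
  by apply/tnthP; rewrite (perm_mem lmu) mem_tnth.
(* The value [mu_i] cannot occur in the fermionic part of [l]: to the left of i the entries exceed
   [l_i > mu_i], and to the right [l_k = mu_i > mu_k] would contradict the choice of i as the last
   excess. *)
have mk : m <= k.
  rewrite leqNgt; apply/negP => km; case: (ltngtP k i) => [ki|ik|/val_inj ki].
  - by have := Sl.1 _ _ ki im; lia.
  - have := Smu.1 _ _ ik km; have := le_mu _ km; have := max_i k; rewrite km /=; lia.
  - by subst k; lia.
have k0P : (m <= k) && (tnth l k < tnth l i) by rewrite mk -lk.
have [j /andP[mj lj] min_j] := @arg_minnP _ k
  (fun j : 'I_N => (m <= j) && (tnth l j < tnth l i)) val k0P.
have ij : i < j := leq_trans im mj.
have nij : i != j by apply/eqP => e; rewrite e ltnn in ij.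
(* The first smaller entry is the largest one below [l_i] in the symmetric part, so after the
   exchange position i still dominates [mu_i = l_k]. *)
have jk : tnth l k <= tnth l j by apply: Sl.2 => //; exact: min_j.
pose l' := comp_swap i j l.
have l'i : tnth l' i = tnth l j by rewrite tnth_mktuple tpermL.
have l'j : tnth l' j = tnth l i by rewrite tnth_mktuple tpermR.
have l'E p : p != i -> p != j -> tnth l' p = tnth l p.
  by move=> pi pj; rewrite tnth_mktuple tpermD // eq_sym.
have le_mu' (p : 'I_N) : p < m -> tnth mu p <= tnth l' p.
  move=> pm; have [->|pi] := eqVneq p i; first by rewrite l'i lk.
  by rewrite l'E ?le_mu //; apply/eqP => e; rewrite e in pm; lia.
apply: connect_trans (bruhat_swap ij lj) _; apply: (IHd l') => //; last first.
- exact: perm_trans (comp_swap_perm _ _ _) lmu.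
- split=> p q.
    move=> pq qm; have qj : q != j by apply/eqP => e; rewrite e in qm; lia.
    have pj : p != j by apply/eqP => e; rewrite e in pq; lia.
    have := Sl.1 _ _ pq qm.
    have [qi|qi] := eqVneq q i.
      have pi : p != i by apply/eqP => e; rewrite e qi ltnn in pq.
      by rewrite qi l'i l'E //; lia.
    rewrite (l'E q) //; have [pi _|pi] := eqVneq p i; last by rewrite l'E.
    rewrite pi l'i; have := max_i q; have := le_mu _ qm.
    by have := Smu.1 _ _ pq qm; rewrite pi in pq *; rewrite qm /=; lia.
  move=> mp pq; have := Sl.2 _ _ mp pq.
  have pi : p != i by apply/eqP => e; rewrite e in mp; lia.
  have qi : q != i by apply/eqP => e; rewrite e in pq; lia.
  have [qj|qj] := eqVneq q j; last first.
    rewrite (l'E q) //; have [pj|pj] := eqVneq p j; last by rewrite l'E.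
    by rewrite pj l'j; lia.
  rewrite qj l'j; have [pj|pj] := eqVneq p j; first by rewrite pj l'j.
  rewrite l'E // => _; rewrite leqNgt; apply/negP => lp; have := min_j p.
  by rewrite mp lp leqNgt -qj ltn_neqAle pq qj pj => /(_ isT).
rewrite ltnS in dP; apply: leq_trans dP; rewrite (bigD1 i) //= [X in _ < X](bigD1 i) //= l'i.
rewrite -addSn leq_add //; first lia.
apply: leq_sum => p /andP[pm pi]; rewrite l'E //.
by apply/eqP => e; rewrite e in pm; lia.
Qed.
End Compositions.

(** * Symmetric superseries *)

Import GRing.Theory Num.Theory.
Local Open Scope fset_scope.
Local Open Scope ring_scope.

(** * Signed action of adjacent transpositions *)

Definition nswap (p i : nat) : nat :=
  if i == p then p.+1 else if i == p.+1 then p else i.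

Lemma nswapP p i : i = p /\ nswap p i = p.+1 \/ i = p.+1 /\ nswap p i = p \/
  i <> p /\ i <> p.+1 /\ nswap p i = i.
Proof.
rewrite /nswap; case: (i =P p) => [->|ip]; first by left.
by right; case: (i =P p.+1) => [->|ip1]; [left|right].
Qed.

Lemma nswapK p : involutive (nswap p).
Proof. by move=> i; have := nswapP p (nswap p i); have := nswapP p i; lia. Qed.

Lemma nswap_lt p i M : (p.+1 < M)%N -> (nswap p i < M)%N = (i < M)%N.
Proof. by move=> pM; have := nswapP p i; lia. Qed.

Definition fset_swap p (S : {fset nat}) : {fset nat} := [fset nswap p i | i in S].

Lemma mem_fset_swap p S i : (i \in fset_swap p S) = (nswap p i \in S).
Proof.
apply/imfsetP/idP => [[j jS ->]|iS]; first by rewrite nswapK.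
by exists (nswap p i); rewrite ?nswapK.
Qed.

Definition xmon_swap p (a : xmon) : xmon :=
  [fsfun i in fset_swap p (finsupp a) => a (nswap p i)].

Lemma xmon_swapE p a i : xmon_swap p a i = a (nswap p i).
Proof. by rewrite fsfunE mem_fset_swap; case: finsuppP. Qed.

Definition smon_swap p (u : smon) : smon := (fset_swap p u.1, xmon_swap p u.2).

Lemma smon_swapK p : involutive (smon_swap p).
Proof.
move=> u; apply: smon_eqP => [|i]; last by rewrite !xmon_swapE nswapK.
by apply/fsetP => i; rewrite !mem_fset_swap nswapK.
Qed.

Lemma smon_swap_div p u v : (smon_swap p v \in sdivs (smon_swap p u)) = (v \in sdivs u).
Proof.
suff h u1 v1 : v1 \in sdivs u1 -> smon_swap p v1 \in sdivs (smon_swap p u1).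
  by apply/idP/idP => [/h|/h //]; rewrite !smon_swapK.
move=> /sdvdP[/fsubsetP vu le_vu]; apply/sdvdP; split=> [|i].
  by apply/fsubsetP => i; rewrite !mem_fset_swap => /vu.
by rewrite !xmon_swapE.
Qed.

Lemma squo_swap p u v : squo (smon_swap p u) (smon_swap p v) = smon_swap p (squo u v).
Proof.
apply: smon_eqP => [|i].
  by apply/fsetP => i; rewrite !(in_fsetD, mem_fset_swap).
by rewrite !(xmonBE, xmon_swapE).
Qed.

Lemma sdivs_swap p u :
  perm_eq (sdivs (smon_swap p u)) [seq smon_swap p v | v <- sdivs u].
Proof.
have inj := can_inj (smon_swapK p).
apply: uniq_perm; rewrite ?map_inj_uniq ?fset_uniq // => v.
rewrite -[v](smon_swapK p) (mem_map inj).
exact: smon_swap_div.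
Qed.

Lemma sum_eq_mem (S : {fset nat}) a : (\sum_(i <- S) (i == a) = (a \in S))%N.
Proof. by rewrite -count_uniq_mem ?fset_uniq // -sum1_count [RHS]big_mkcond; apply: eq_bigr => i _ /=; case: eqP. Qed.

(** Only the relative order of p and p + 1 changes. The identity is written with sums on both sides
    to avoid subtraction in [nat]. *)
Lemma sinv_swap p (S T : {fset nat}) :
  (sinv (fset_swap p S) (fset_swap p T) + (p.+1 \in S) * (p \in T) =
   sinv S T + (p \in S) * (p.+1 \in T))%N.
Proof.
have mulE a b : ((a \in S) * (b \in T) =
    \sum_(i <- S) \sum_(j <- T) (i == a) * (j == b))%N.
  by rewrite -!sum_eq_mem big_distrlr.
have inj := can_inj (nswapK p).
have bigE F (U : {fset nat}) :
    (\sum_(i <- fset_swap p U) F i = \sum_(i <- U) F (nswap p i))%N.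
  by rewrite big_imfset // => x y _ _ /inj.
rewrite !mulE /sinv bigE; under eq_bigr do rewrite bigE.
rewrite -!big_split; apply: eq_bigr => i _ /=; rewrite -!big_split.
by apply: eq_bigr => j _ /=; have := nswapP p i; have := nswapP p j; lia.
Qed.

(** The sign produced by reordering theta_S after the exchange of the indices p and p + 1. *)
Definition swap_sign p (S : {fset nat}) : rat := (-1) ^+ ((p \in S) && (p.+1 \in S)).

(** The cocycle identity that makes [sser_swap] multiplicative, so that invariance passes to
    products of superseries. *)
Lemma swap_signM p (S T : {fset nat}) : [disjoint S & T] ->
  swap_sign p (S `|` T) * (-1) ^+ sinv (fset_swap p S) (fset_swap p T) =
  (-1) ^+ sinv S T * swap_sign p S * swap_sign p T.
Proof.
move=> /fdisjointP dST; rewrite /swap_sign -!exprD -[LHS]signr_odd -[RHS]signr_odd.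
congr (_ ^+ nat_of_bool _); have := congr1 odd (sinv_swap p S T).
rewrite !oddD !oddM !oddb !in_fsetU.
have := dST p; have := dST p.+1.
case: (p \in S); case: (p.+1 \in S); case: (p \in T); case: (p.+1 \in T) => h1 h2;
  try by [have := h1 isT | have := h2 isT].
all: by case: (odd _); case: (odd _).
Qed.

Definition sser_swap p (f : sser) : sser :=
  fun u => swap_sign p u.1 * f (smon_swap p u).

Lemma sser_mulE (f g : sser) u : (f * g) u =
  \sum_(v <- sdivs u) (-1) ^+ sinv v.1 (squo u v).1 * f v * g (squo u v).
Proof. by []. Qed.

Lemma sser_swap_is_zmod p : zmod_morphism (sser_swap p).
Proof.
move=> f g; apply: functional_extensionality_dep => u.
exact: mulrBr.
Qed.

Lemma sser_swap_is_monoid p : monoid_morphism (sser_swap p).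
Proof.
split.
  apply: functional_extensionality_dep => u; rewrite /sser_swap.
  have one_swap : smon_swap p smon1 = smon1.
    apply: smon_eqP => [|i]; last by rewrite xmon_swapE !xmon1E.
    by apply/fsetP => i; rewrite mem_fset_swap.
  rewrite (_ : (1 : sser) = sdelta smon1) // /sdelta.
  rewrite -{1}one_swap (inj_eq (can_inj (smon_swapK p))).
  case: eqP => [->|]; last by rewrite mulr0.
  by rewrite /swap_sign !in_fset0 mulr1.
move=> f g; apply: functional_extensionality_dep => u; rewrite /sser_swap.
rewrite !sser_mulE (perm_big _ (sdivs_swap p u)) big_map mulr_sumr.
rewrite big_seq [RHS]big_seq; apply: eq_bigr => v /sdvdP[vu _]; rewrite squo_swap.
rewrite -[u.1](fsetUDK_ vu).
rewrite !mulrA [swap_sign p _ * _]swap_signM ?fdisjointDr_ //.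
by rewrite /= -!mulrA; congr (_ * (_ * _)); rewrite mulrCA.
Qed.

HB.instance Definition _ p :=
  GRing.isZmodMorphism.Build sser sser (sser_swap p) (sser_swap_is_zmod p).
HB.instance Definition _ p :=
  GRing.isMonoidMorphism.Build sser sser (sser_swap p) (sser_swap_is_monoid p).

(** The bound M allows for superpolynomials such as [mono_fin N L], which are symmetric in their
    first N variables only. *)
Definition swap_inv (M : nat) (f : sser) : Prop :=
  forall p, (p.+1 < M)%N -> sser_swap p f = f.

Lemma sser_scaleE c (f : sser) u : (c *: f) u = c * f u. Proof. by []. Qed.
Lemma sser_addE (f g : sser) u : (f + g) u = f u + g u. Proof. by []. Qed.

Lemma sser_sumE I r (P : pred I) (F : I -> sser) u :
  (\sum_(i <- r | P i) F i) u = \sum_(i <- r | P i) F i u.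
Proof. exact: (big_morph (fun f : sser => f u) (fun f g => sser_addE f g u) erefl). Qed.

Lemma sser_scaleAl c (f g : sser) : (c *: f) * g = c *: (f * g).
Proof.
apply: functional_extensionality_dep => u; rewrite sser_scaleE !sser_mulE mulr_sumr.
by apply: eq_bigr => v _; rewrite sser_scaleE mulrCA !mulrA.
Qed.

Lemma sser_scaleAr c (f g : sser) : f * (c *: g) = c *: (f * g).
Proof.
apply: functional_extensionality_dep => u; rewrite sser_scaleE !sser_mulE mulr_sumr.
by apply: eq_bigr => v _; rewrite sser_scaleE mulrCA.
Qed.

Lemma sser_swapZ p c f : sser_swap p (c *: f) = c *: sser_swap p f.
Proof. by apply: functional_extensionality_dep => u; rewrite /sser_swap !sser_scaleE mulrCA. Qed.

Lemma swap_sign_swap p S : swap_sign p (fset_swap p S) = swap_sign p S.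
Proof.
rewrite /swap_sign !mem_fset_swap /nswap eqxx.
by rewrite (gtn_eqF (ltnSn p)) eqxx andbC.
Qed.

Lemma sser_swap_sdelta p u : sser_swap p (sdelta u) = swap_sign p u.1 *: sdelta (smon_swap p u).
Proof.
apply: functional_extensionality_dep => v; rewrite sser_scaleE /sser_swap /sdelta.
rewrite -{1}[u](smon_swapK p) (inj_eq (can_inj (smon_swapK p))).
by case: eqP => [->|]; rewrite ?mulr0 // swap_sign_swap.
Qed.

Lemma sser_swap_theta p i : sser_swap p (theta i) = theta (nswap p i).
Proof.
rewrite /theta sser_swap_sdelta /swap_sign !in_fset1.
rewrite (_ : (_ && _) = false) ?scale1r; last by lia.
congr sdelta; apply: smon_eqP => [|j]; last by rewrite xmon_swapE !xmon1E.
apply/fsetP => j; rewrite mem_fset_swap !in_fset1.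
exact: (can2_eq (nswapK p) (nswapK p)).
Qed.

Lemma sser_swap_xvar p i : sser_swap p (xvar i) = xvar (nswap p i).
Proof.
rewrite /xvar sser_swap_sdelta /swap_sign !in_fset0 scale1r.
congr sdelta; apply: smon_eqP => [|j].
  by apply/fsetP => j; rewrite mem_fset_swap.
rewrite xmon_swapE !xmonUE; congr nat_of_bool.
exact: (can2_eq (nswapK p) (nswapK p)).
Qed.

(** * Products of variables as signed monomials *)

Definition xm (a : xmon) : sser := sdelta (fset0, a).

Lemma xm_ext (a b : xmon) : a =1 b -> xm a = xm b.
Proof. by move=> /fsfunP ->. Qed.

Lemma xmM a b : xm a * xm b = xm (xmonM a b).
Proof. by rewrite sdeltaM fdisjoint0X sinv0l expr0 scale1r /smonM /= fset0U. Qed.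

Lemma xm_prod I r (P : pred I) (F : I -> xmon) :
  exists2 a, \prod_(i <- r | P i) xm (F i) = xm a
           & forall j, a j = (\sum_(i <- r | P i) F i j)%N.
Proof.
elim: r => [|i r [a ea aE]].
  by exists xmon1 => [|j]; rewrite big_nil ?xmon1E.
exists (if P i then xmonM (F i) a else a) => [|j]; rewrite big_cons; case: (P i) => //.
  by rewrite ea xmM.
by rewrite xmonME aE.
Qed.

Lemma xvar_prod I r (P : pred I) (F : I -> nat) (k : I -> nat) :
  exists2 a, \prod_(i <- r | P i) xvar (F i) ^+ k i = xm a
           & forall j, a j = (\sum_(i <- r | P i) k i * (j == F i))%N.
Proof.
have xk i : exists a : xmon, xvar (F i) ^+ k i = xm a /\ forall j, a j = (k i * (j == F i))%N.
  have := @xm_prod 'I_(k i) (index_enum _) xpredT (fun=> xmonU (F i)).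
  rewrite big_const_ord -[iter _ _ _]/(_) => -[a ea aE]; exists a; split.
    by rewrite -ea; elim: (k i) => //= n IHn; rewrite exprS IHn.
  by move=> j; rewrite aE sum_nat_const card_ord xmonUE.
have [h hE] := choice xk; have [a ea aE] := xm_prod r P h.
exists a => [|j]; first by rewrite -ea; apply: eq_bigr => i _; case: (hE i).
by rewrite aE; apply: eq_bigr => i _; case: (hE i).
Qed.

Lemma sdelta_xm S a : sdelta (S, xmon1) * xm a = sdelta (S, a).
Proof.
rewrite sdeltaM fdisjointX0 sinv0r expr0 scale1r /smonM /= fsetU0.
by congr (sdelta (_, _)); apply/fsfunP => j; rewrite xmonME xmon1E.
Qed.

(** The sign is made explicit for increasing lists only: the permutations that contribute to a
    canonical coefficient fix the fermionic indices. *)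
Lemma theta_prod (r : seq nat) : uniq r ->
  exists2 k, \prod_(i <- r) theta i = (-1) ^+ k *: sdelta ([fset i in r], xmon1)
           & sorted ltn r -> k = 0%N.
Proof.
elim: r => [_|i r IHr /= /andP[ir /IHr{IHr}[k ek kE]]].
  exists 0%N => //; rewrite big_nil expr0 scale1r; congr sdelta.
  by apply: smon_eqP => //=; apply/fsetP => i; rewrite !inE.
exists (k + sinv [fset i] [fset j in r])%N.
  rewrite big_cons ek sser_scaleAr sdeltaM /= fdisjoint1X !inE ir /= scalerA exprD.
  congr (_ *: sdelta _); apply: smon_eqP => [|j] /=.
    by apply/fsetP => j; rewrite !inE.
  by rewrite xmonME !xmon1E.
move=> /[dup] /path_sorted /kE -> /(order_path_min ltn_trans) /allP ltir.
rewrite add0n /sinv big_seq_fset1 big_seq big1 // => j; rewrite inE /= => /ltir /=.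
by rewrite ltnNge => /negPf; case: ltngtP.
Qed.

Lemma mono_fin_swap N n m (L : SPar n m) : swap_inv N (mono_fin N L).
Proof.
move=> p pN; rewrite /mono_fin sser_swapZ; congr (_ *: _).
rewrite raddf_sum /=.
pose P : 'I_N := Ordinal (ltnW pN); pose Q : 'I_N := Ordinal pN.
rewrite [RHS](reindex_inj (mulIg (tperm P Q))) /=; apply: eq_bigr => s _.
have tE i : nswap p (s i) = ((s * tperm P Q)%g i).
  rewrite permM; case: tpermP => [->|->|/eqP nP /eqP nQ] /=.
  - by rewrite /nswap eqxx.
  - by rewrite /nswap (gtn_eqF (ltnSn p)) eqxx.
  - by rewrite /nswap -[p]/(val P) -[p.+1]/(val Q) !val_eqE (negPf nP) (negPf nQ).
rewrite rmorphM !rmorph_prod /=; congr (_ * _); apply: eq_bigr => i _.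
  by rewrite sser_swap_theta tE.
by rewrite rmorphXn /= sser_swap_xvar tE.
Qed.

(** * Counting colour-preserving permutations *)

Lemma card_color_perm (T : finType) (D : {set T}) (c : T -> nat) (cs : seq nat) :
  uniq cs ->
  #|[set s : {perm T} | perm_on [set x in D | c x \in cs] s
                        & [forall (x | x \in D), (s x \in D) && (c (s x) == c x)]]| =
  (\prod_(k <- cs) (#|[set x in D | c x == k]|)`!)%N.
Proof.
pose F k := [set x in D | c x == k]%SET.
pose E (ks : seq nat) := [set x in D | c x \in ks]%SET.
pose G (ks : seq nat) := [set s : {perm T} | perm_on (E ks) s
  & [forall (x | x \in D), (s x \in D) && (c (s x) == c x)]]%SET.
rewrite -/(G cs); elim: cs => [_|k ks IHks /= /andP[kks /IHks{}IHks]].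
  rewrite big_nil (_ : G [::] = [set 1%g]%SET) ?cards1 //.
  apply/setP => s; rewrite !inE; apply/andP/eqP => [[/out_perm e _]|->].
    by apply/permP => x; rewrite perm1 e // !inE andbF.
  rewrite perm_on1; split=> //; apply/forall_inP => x xD.
  by rewrite perm1 xD eqxx.
(* One colour class is split off: s is its restriction to the class k times a permutation supported
   on the remaining classes, and this factorisation is unique. *)
rewrite big_cons -IHks -card_perm -[#|perm_on _|]cardsE -cardsX.
rewrite -[RHS](card_in_imset (f := fun p : {perm T} * {perm T} => (p.1 * p.2)%g)).
  apply: eq_card => s; rewrite inE; apply/andP/imsetP.
    move=> [sE /forall_inP sD].
    have sF x : (s x \in F k) = (x \in F k).
      rewrite !inE; case xD: (x \in D); first by have /andP[-> /eqP->] := sD x xD.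
      by rewrite (out_perm sE) ?inE ?xD.
    have sN : s \in 'N(F k | 'P)%g.
      by rewrite inE; apply/andP; split; rewrite ?inE //; apply/subsetP => x xF; rewrite inE /= apermE sF.
    exists (restr_perm (F k) s, (restr_perm (F k) s)^-1 * s)%g; last by rewrite mulKVg.
    have sV x : (restr_perm (F k) s)^-1%g x = if x \in F k then s^-1%g x else x.
      apply: (@perm_inj _ (restr_perm (F k) s)); rewrite permKV; case: ifP => xF.
        by rewrite restr_permE ?permKV // -sF permKV.
      by rewrite (out_perm (restr_perm_on _ _)) ?xF.
    rewrite in_setX !in_set; apply/andP; split; first exact: restr_perm_on.
    apply/andP; split.
      apply/subsetP => x; rewrite inE permM sV; apply: contraR => xE.
      case: ifP => xF; first by rewrite permKV.
      rewrite (out_perm sE) //; apply: contra xE; rewrite !inE => /andP[xD].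
      by rewrite xD /= => /orP[ck|->//]; move: xF; rewrite inE xD ck.
    apply/forall_inP => x xD; rewrite permM sV; case: ifP => xF; last exact: sD.
    by rewrite permKV xD eqxx.
  case=> -[a b]; rewrite in_setX !in_set => /andP[/= aF] /andP[/= bE /forall_inP bD] ->.
  have aP x : x \in D -> (a x \in D) && (c (a x) == c x).
    move=> xD; case xF: (x \in F k); last by rewrite (out_perm aF) ?xF // xD eqxx.
    have := xF; rewrite -(perm_closed x aF) /F !inE => /andP[-> /eqP ->].
    by move: xF; rewrite inE xD /= eq_sym.
  split.
    apply/subsetP => x; rewrite inE permM; apply: contraR => xE.
    rewrite (out_perm aF) ?(out_perm bE) //; apply: contra xE; rewrite !inE => /andP[-> ->] //.
    by rewrite orbT.
  apply/forall_inP => x xD; rewrite permM; have /andP[/[dup] aD /bD /andP[-> /eqP ->]] := aP x xD.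
  by have /andP[] := aP x xD.
move=> [a b] [a' b']; rewrite !in_setX !in_set /=.
move=> /andP[aF /andP[bE _]] /andP[aF' /andP[bE' _]] e.
have fixb d x : perm_on (E ks) d -> x \in F k -> d x = x.
  move=> dE; rewrite inE => /andP[xD /eqP cx]; rewrite (out_perm dE) // inE xD /= cx.
  exact: kks.
have ea : a = a'.
  apply/permP => x; case xF: (x \in F k); last by rewrite !(@out_perm _ (F k)) ?xF.
  have /permP/(_ x) := e; rewrite !permM (fixb b) ?(perm_closed _ aF) //.
  by rewrite (fixb b') ?(perm_closed _ aF').
by move: e; rewrite ea => /mulgI ->.
Qed.

(** * Monomial superfunctions at canonical monomials *)

Definition xseq (s : seq nat) : xmon := [fsfun i in [fset i in iota 0 (size s)] => nth 0%N s i].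

Lemma xseqE s i : xseq s i = nth 0%N s i.
Proof.
rewrite fsfunE !inE /= mem_iota /=; case: ifPn => //.
by rewrite -leqNgt => h; rewrite nth_default.
Qed.

(** The monomial theta_0 ... theta_(k-1) x^(A,S), with k the size of A, at which the coefficient of
    a symmetric superseries is read. *)
Definition canon (A S : seq nat) : smon := ([fset i in iota 0 (size A)], xseq (A ++ S)).

(** The conditions on a superpartition with the two degrees left free, so that the vanishing of a
    superseries in all other degrees can be expressed. *)
Definition is_canon (A S : seq nat) : bool :=
  [&& sorted gtn A, sorted geq S & 0%N \notin S].

Lemma spar_canon n m (L : SPar n m) : is_canon (spa L) (sps L).
Proof. by have [_ ? ? ? _] := sparP L; apply/and3P. Qed.

Lemma canon_uniq A S : is_canon A S -> uniq A.
Proof.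
move=> /and3P[srt _ _]; apply: (sorted_uniq _ _ srt) => [y x z|x] /=; last by rewrite ltnn.
by move=> yx zy; exact: ltn_trans zy yx.
Qed.

Lemma tuple_pad N (s : seq nat) : (size s <= N)%N ->
  [tuple nth 0%N s i | i < N] = s ++ nseq (N - size s) 0%N :> seq nat.
Proof.
move=> sN; apply: (@eq_from_nth _ 0%N); rewrite ?size_tuple ?size_cat ?size_nseq ?subnKC // => i iN.
rewrite -[i in LHS]/(val (Ordinal iN)) -tnth_nth tnth_mktuple nth_cat nth_nseq.
by case: ltnP => // h; rewrite if_same nth_default.
Qed.

Lemma spar_comp_pad N n m (L : SPar n m) : (slen L <= N)%N ->
  spar_comp N L = (spa L ++ sps L) ++ nseq (N - slen L) 0%N :> seq nat.
Proof.
have [sza _ _ _ _] := sparP L.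
by move=> LN; rewrite tuple_pad size_cat sza.
Qed.

Lemma canon_eq A S A' S' N : is_canon A S -> is_canon A' S' -> perm_eq A A' ->
  (size A + size S <= N)%N -> (size A' + size S' <= N)%N ->
  perm_eq [tuple nth 0%N (A ++ S) i | i < N] [tuple nth 0%N (A' ++ S') i | i < N] ->
  A = A' /\ S = S'.
Proof.
move=> /and3P[srtA srtS S0] /and3P[srtA' srtS' S0'] pA.
rewrite -!size_cat => szN szN'; rewrite !tuple_pad // -!catA; split.
  apply: (sorted_eq _ _ srtA srtA' pA) => [y x z /= yx zy|]; first exact: ltn_trans zy yx.
  by move=> x y /andP[/= /ltnW xy /ltnW yx]; apply/eqP; rewrite eqn_leq yx xy.
apply: (sorted_eq geq_trans_ _ srtS srtS').
  by move=> x y /andP[/= xy yx]; apply/eqP; rewrite eqn_leq yx xy.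
have /(perm_filter (predC1 0%N)) : perm_eq (S ++ nseq (N - size (A ++ S)) 0%N) (S' ++ nseq (N - size (A' ++ S')) 0%N).
  by rewrite -(perm_cat2l A) (perm_trans H) // perm_cat2r perm_sym.
have filt0 k : [seq x <- nseq k 0%N | predC1 0%N x] = [::] by elim: k.
have filtS (s : seq nat) : 0%N \notin s -> [seq x <- s | predC1 0%N x] = s.
  by move=> s0; apply/all_filterP/allP => x xs /=; apply: contraNneq s0 => <-.
by rewrite !filter_cat !filt0 !cats0 !filtS.
Qed.

Lemma count_drop_tuple N (t : N.-tuple nat) m (P : pred nat) :
  count P (drop m t) = #|[set i : 'I_N | (m <= i)%N & P (tnth t i)]|.
Proof.
have -> : drop m t = [seq nth 0%N t i | i <- iota m (N - m)].
  have [mN|Nm] := leqP m N.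
    by rewrite map_nth_iota ?size_tuple ?subnKC // take_oversize // size_drop size_tuple.
  move/ltnW: Nm => Nm; rewrite drop_oversize ?size_tuple //.
  by move: Nm; rewrite -subn_eq0 => /eqP ->.
rewrite count_map -sum1_count -/(index_iota m N) (big_nat_widenl _ 0) // big_mkord -sum1_card.
by apply: eq_bigl => i; rewrite inE (tnth_nth 0%N) andbC.
Qed.

(** The permutations whose term in [mono_fin] is exactly the canonical monomial of L. Their number
    is the normalising factor [nfact]. *)
Definition comp_stab N n m (L : SPar n m) : {set 'S_N} :=
  [set s : 'S_N | [forall (i : 'I_N | (i < m)%N), s i == i]
    & [forall i, tnth (spar_comp N L) (s i) == tnth (spar_comp N L) i]].

Lemma nfact_stab N n m (L : SPar n m) : nfact N L = #|comp_stab N L|.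
Proof.
rewrite /nfact /comp_stab; set t := spar_comp N L.
under eq_bigr do rewrite (count_drop_tuple t).
pose D := [set i : 'I_N | (m <= i)%N].
have ED : [set x in D | tnth t x \in undup (drop m t)] = D.
  apply/setP => i; rewrite !inE; case mi: (m <= i)%N => //=.
  rewrite mem_undup -has_pred1 has_count (count_drop_tuple t).
  by apply/card_gt0P; exists i; rewrite !inE mi eqxx.
have := @card_color_perm _ D (tnth t) (undup (drop m t)) (undup_uniq _).
rewrite ED; under [RHS]eq_bigr => k _.
  rewrite (_ : [set x in D | _] = [set i : 'I_N | (m <= i)%N & pred1 k (tnth t i)]).
  over.
  by apply/setP => i; rewrite !inE.
move=> <-; apply: eq_card => s; rewrite !inE; apply/andP/andP.
  move=> [sD /forall_inP sc]; have sE (i : 'I_N) : (i < m)%N -> s i = i.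
    by move=> im; rewrite (out_perm sD) // inE -ltnNge.
  split; first by apply/forall_inP => i /sE ->.
  apply/forallP => i; have [mi|/sE-> //] := leqP m i.
  by have /andP[] : (s i \in D) && (tnth t (s i) == tnth t i) by apply: sc; rewrite inE.
move=> [/forall_inP sE /forallP sc].
have sD (i : 'I_N) : (m <= i)%N -> (m <= s i)%N.
  move=> mi; rewrite leqNgt; apply/negP => sim.
  by have /eqP/perm_inj si := sE (s i) sim; rewrite si ltnNge mi in sim.
split.
  by apply/subsetP => i; rewrite !inE leqNgt; apply: contraNN => /sE.
by apply/forall_inP => i; rewrite !inE => mi; rewrite sD // sc.
Qed.

(** Each term is a signed monomial. If it is canonical, its thetas show that s preserves the indices
    below m, and its exponents show that A is a rearrangement of [spa L], hence equal to it. As the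
    entries of A are distinct, s fixes every index below m and the sign is 1. *)
Lemma mono_term_canon N n m (L : SPar n m) (s : 'S_N) A S :
  (slen L <= N)%N -> (size A + size S <= N)%N -> is_canon A S ->
  let g := (\prod_(i < N | (i < m)%N) theta (s i)) *
    \prod_(i < N) xvar (s i) ^+ tnth (spar_comp N L) i in
  g (canon A S) = (((A, S) == spar_val L) && (s \in comp_stab N L))%:R.
Proof.
move=> LN ASN cAS; have [sza _ _ _ _] := sparP L.
have [a ea aE] := xvar_prod (index_enum 'I_N) xpredT (fun i => s i : nat)
  (fun i => tnth (spar_comp N L) i).
pose r := [seq val (s i) | i : 'I_N <- [seq i : 'I_N <- index_enum _ | (i < m)%N]].
have ur : uniq r.
  rewrite map_inj_uniq ?filter_uniq ?index_enum_uniq //.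
  by move=> i j /val_inj/perm_inj.
have aS i : a (s i) = tnth (spar_comp N L) i.
  rewrite aE (bigD1 i) //= eqxx muln1 big1 ?addn0 // => j ji.
  by rewrite eq_sym (inj_eq val_inj) (inj_eq perm_inj) (negPf ji) muln0.
have mem_r (i : 'I_N) : (val (s i) \in r) = (i < m)%N.
  apply/mapP/idP => [[j]|im].
    by rewrite mem_filter => /andP[jm _] /val_inj/perm_inj ->.
  by exists i; rewrite // mem_filter im mem_index_enum.
have mN : (m <= N)%N by apply: leq_trans LN; exact: leq_addr.
have szr : size r = m.
  rewrite size_map size_filter -sum1_count (big_ord_narrow mN) /=.
  by rewrite sum1_card card_ord.
have [k ek kE] := theta_prod ur; move=> g.
have gE : g (canon A S) = (-1) ^+ k * ((canon A S) == ([fset i in r], a))%:R.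
  by rewrite /g ea -big_filter -(big_map (fun i => val (s i)) xpredT theta) ek
    sser_scaleAl sdelta_xm sser_scaleE.
rewrite gE.
have [eu|nu] := eqVneq (canon A S) ([fset i in r], a); last first.
  rewrite mulr0; case: andP => // -[/eqP eL sst]; case/eqP: nu.
  move: sst; rewrite inE => /andP[/forall_inP sE /forallP sc].
  move: gE; rewrite -[A]/((A, S).1) -[S]/((A, S).2) eL => _.
  apply: smon_eqP => [|i] /=.
    apply/fsetP => i; rewrite !inE /= sza mem_iota /=.
    apply/idP/mapP => [im|[j]].
      exists (Ordinal (leq_trans im mN)); rewrite ?mem_filter ?mem_index_enum ?im //.
      by have /eqP -> := sE (Ordinal (leq_trans im mN)) im.
    by rewrite mem_filter => /andP[jm _] ->; have /eqP-> := sE j jm.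
  rewrite xseqE; have [iN|Ni] := ltnP i N.
    rewrite -[i]/(val (Ordinal iN)) -(permKV s (Ordinal iN)) aS permKV.
    have /eqP := sc (s^-1%g (Ordinal iN)); rewrite permKV => <-.
    by rewrite tnth_mktuple.
  rewrite nth_default ?size_cat ?sza ?(leq_trans LN) // aE big1 // => j _.
  by rewrite (_ : (i == _) = false) ?muln0 //; have := ltn_ord (s j); lia.
have [e1 e2] : [fset i in iota 0 (size A)] = [fset i in r] /\ xseq (A ++ S) = a by case: eu.
have szA : size A = m.
  have := congr1 (fun X : {fset nat} => #|` X|) e1.
  by rewrite !card_fseq !undup_id ?iota_uniq // size_iota szr.
have lt_s i : (val (s i) < m)%N = (i < m)%N.
  by rewrite -mem_r; have /fsetP/(_ (val (s i))) := e1; rewrite !inE /= mem_iota szA /= => ->.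
have ASs i : nth 0%N (A ++ S) (s i) = nth 0%N (spa L ++ sps L) i.
  by rewrite -xseqE e2 aS tnth_mktuple.
have sA (i : 'I_N) : (i < m)%N -> nth 0%N A (s i) = nth 0%N (spa L) i.
  by move=> im; have := ASs i; rewrite !nth_cat szA sza lt_s im.
have uA := canon_uniq cAS.
have pA : perm_eq A (spa L).
  rewrite perm_sym; apply: uniq_perm (spa_uniq L) uA _.
  apply: (uniq_min_size (spa_uniq L) _ _).2; last by rewrite szA sza.
  move=> x /(nthP 0%N)[i]; rewrite sza => im <-.
  pose j := Ordinal (leq_trans im mN).
  by rewrite -[i]/(val j) -sA // mem_nth // szA lt_s.
have [eA eS] : A = spa L /\ S = sps L.
  apply: (canon_eq cAS (spar_canon L) pA ASN); first by rewrite sza.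
  rewrite perm_sym; apply/tuple_permP; exists s; congr val.
  by apply: eq_from_tnth => i; rewrite !tnth_mktuple ASs.
have sE (i : 'I_N) : (i < m)%N -> s i = i.
  move=> im; have := sA i im; rewrite -eA => /eqP.
  by rewrite nth_uniq ?szA ?lt_s // => /eqP /val_inj.
rewrite kE; last first.
  rewrite /r; rewrite (eq_in_map _ val _).1; last first.
    by move=> i; rewrite mem_filter => /andP[/sE ->].
  rewrite -(filter_map val (fun i => i < m)%N) sorted_filter //; first exact: ltn_trans.
  by rewrite [index_enum _]unlock -enumT val_enum_ord iota_ltn_sorted.
rewrite expr0 mul1r eA eS (_ : _ && _ = true) //; apply/andP; split.
  by case: (L) => -[].
rewrite inE; apply/andP; split; first by apply/forall_inP => i /sE ->.
by apply/forallP => i; rewrite [tnth _ (s i)]tnth_mktuple -eA -eS ASs tnth_mktuple.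
Qed.

Lemma mono_fin_canon N n m (L : SPar n m) A S :
  (slen L <= N)%N -> (size A + size S <= N)%N -> is_canon A S ->
  mono_fin N L (canon A S) = ((A, S) == spar_val L)%:R.
Proof.
move=> LN ASN cAS; rewrite /mono_fin sser_scaleE sser_sumE.
under eq_bigr => s _ do rewrite mono_term_canon //.
case: eqP => _; last by rewrite big1 ?mulr0.
rewrite -natr_sum -big_mkcond /= sum1_card -nfact_stab mulVf // pnatr_eq0 -lt0n.
by rewrite nfact_stab; apply/card_gt0P; exists 1%g; rewrite inE; apply/andP; split;
  apply/forallP => i; rewrite ?perm1 ?eqxx ?implybT.
Qed.


(** * Reduction of a monomial to a canonical one *)

Lemma nth_filter_pos (s : seq nat) i : sorted geq s ->
  nth 0%N [seq x <- s | x != 0%N] i = nth 0%N s i.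
Proof.
elim: s i => //= x s IHs i.
rewrite (path_sortedE geq_trans_) => /andP[/allP xs srt].
case: eqP => [x0|_] /=; last by case: i => //= i; rewrite IHs.
have s0 y : y \in s -> y = 0%N by move=> /xs; rewrite x0 /= leqn0 => /eqP.
rewrite (_ : filter _ s = [::]) ?nth_nil; last first.
  by apply/eqP; rewrite -(negbK (_ == _)) -has_filter; apply/hasPn => y /s0 ->.
case: i => [|i] //=; have [js|js] := ltnP i (size s); last by rewrite nth_default.
by rewrite (s0 _ (mem_nth _ js)).
Qed.

(* Bubble sort. The keys put fermionic indices first and larger exponents
   first within each kind; swapping two adjacent indices with keys in the wrong
   order lowers [\sum_i i * key i]. *)
Lemma canon_reduce M (u : smon) :
  (forall i, i \in u.1 -> (i < M)%N) -> (forall i, (M <= i)%N -> u.2 i = 0%N) ->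
  exists c A S, [/\ is_canon A S, (size A + size S <= M)%N &
    forall f, swap_inv M f -> f u = c * f (canon A S)].
Proof.
have [B ltB] : exists B, forall i, (u.2 i < B)%N.
  exists (\sum_(i <- finsupp u.2) u.2 i).+1 => i; rewrite ltnS.
  case: finsuppP => // iu; rewrite (big_rem i) //=; exact: leq_addr.
pose key (u : smon) i := ((i \in u.1) * B + u.2 i)%N.
have [d] := ubnP (\sum_(i < M) i * key u i)%N.
elim: d u ltB => // d IHd u ltB dP u1 u2.
have keyP i : (i \in u.1) = (B <= key u i)%N.
  by rewrite /key; have := ltB i; case: (i \in u.1) => /=; lia.
have [/existsP[P /existsP[Q /andP[/eqP QP kPQ]]]|/existsPn h1] :=
    boolP [exists P : 'I_M, exists Q : 'I_M, (Q == P.+1 :> nat) && (key u P < key u Q)%N].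
  have pM : (P.+1 < M)%N by rewrite -QP.
  pose v := smon_swap P u.
  have kv i : key v i = key u (nswap P i) by rewrite /key mem_fset_swap xmon_swapE.
  have [] := IHd v.
  - by move=> i; rewrite xmon_swapE.
  - rewrite ltnS in dP; apply: leq_trans dP.
    have nPQ : Q != P by rewrite -val_eqE /= QP; lia.
    rewrite (bigD1 P) //= (bigD1 Q) //= [X in (_ < X)%N](bigD1 P) //= [X in (_ < _ + X)%N](bigD1 Q) //=.
    rewrite (eq_bigr (fun i : 'I_M => i * key u i)%N); last first.
      move=> i /andP[/eqP iP /eqP iQ]; rewrite kv; congr (_ * key u _)%N.
      have := nswapP P i; rewrite -QP; case=> [[/val_inj //]|[[/val_inj //]|[_ [_ ->]]] //].
    rewrite !kv.
    have ePQ : nswap P P = Q by rewrite /nswap eqxx QP.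
    have -> : nswap P Q = P by rewrite -ePQ nswapK.
    rewrite ePQ !addnA ltn_add2r; move: (key u P) (key u Q) kPQ => a b ab.
    by rewrite QP !mulSn; lia.
  - by move=> i; rewrite mem_fset_swap => /u1; rewrite nswap_lt.
  - by move=> i Mi; rewrite xmon_swapE u2 // leqNgt nswap_lt // -leqNgt.
  move=> c [A [S [cAS szAS cP]]]; exists (swap_sign P u.1 * c), A, S; split=> // f fM.
  by rewrite -{1}(fM P pM) /sser_swap -mulrA -cP.
have [/existsP[P /existsP[Q /and4P[/eqP QP Pu Qu /eqP aPQ]]]|/existsPn h2] :=
    boolP [exists P : 'I_M, exists Q : 'I_M,
      [&& Q == P.+1 :> nat, val P \in u.1, val Q \in u.1 & u.2 P == u.2 Q]].
  have pM : (P.+1 < M)%N by rewrite -QP.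
  (* Exchanging two adjacent fermionic indices with equal exponents fixes the monomial and changes
     the sign, so [f u = - f u] vanishes. The empty sequences are mere placeholders for the
     coefficient 0. *)
  exists 0, [::], [::]; split=> // f fM; rewrite mul0r.
  have /eqP : f u = - f u.
    rewrite -{1}(fM P pM) /sser_swap /swap_sign -QP Pu Qu mulN1r; congr (- f _).
    apply: smon_eqP => [|i].
      apply/fsetP => i; rewrite mem_fset_swap.
      by have := nswapP P i; rewrite -QP; case=> [[-> ->]|[[-> ->]|[_ [_ ->]]]] //; rewrite Pu Qu.
    by rewrite xmon_swapE; have := nswapP P i; rewrite -QP; case=> [[-> ->]|[[-> ->]|[_ [_ ->]]]] //.
  by rewrite -addr_eq0 -mulr2n mulrn_eq0 => /eqP.
have keyS p : (p.+1 < M)%N -> (key u p.+1 <= key u p)%N.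
  move=> pM; have /existsPn/(_ (Ordinal pM)) := h1 (Ordinal (ltnW pM)).
  by rewrite eqxx -leqNgt.
have key_anti i j : (i <= j)%N -> (j < M)%N -> (key u j <= key u i)%N.
  move=> /subnKC <-; elim: (j - i)%N => [|k IHk]; first by rewrite addn0.
  by rewrite addnS => ikM; apply: leq_trans (keyS _ ikM) (IHk (ltnW ikM)).
(* No adjacent pair has keys in the wrong order any more. As a key reaches B exactly at the
   fermionic indices, these form the initial segment of length m. *)
pose m := find (fun i => i \notin u.1) (iota 0 M).
have mM : (m <= M)%N by rewrite -[X in (_ <= X)%N](size_iota 0 M) find_size.
have mem_u1 i : (i \in u.1) = (i < m)%N.
  apply/idP/idP => [iu|im]; last first.
    have := before_find 0%N im; rewrite nth_iota ?(leq_trans im) // add0n.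
    by move/negbFE.
  rewrite ltnNge; apply/negP => mi; have iM := u1 _ iu.
  have mM' : (m < M)%N := leq_ltn_trans mi iM.
  have := @nth_find _ 0%N (fun i => i \notin u.1) (iota 0 M).
  rewrite has_find size_iota => /(_ mM'); rewrite nth_iota // add0n.
  by move/negP; apply; rewrite keyP (leq_trans _ (key_anti _ _ mi iM)) // -keyP.
pose A := [seq u.2 i | i <- iota 0 m]; pose R := [seq u.2 i | i <- iota m (M - m)].
have nthR i : nth 0%N R i = u.2 (m + i)%N.
  have [iM|Mi] := ltnP i (M - m); first by rewrite (nth_map 0%N) ?size_iota ?nth_iota.
  by rewrite nth_default ?size_map ?size_iota // u2 // -(subnKC mM) leq_add2l.
have nthA i : (i < m)%N -> nth 0%N A i = u.2 i.
  by move=> im; rewrite (nth_map 0%N) ?size_iota ?nth_iota.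
have srtR : sorted geq R.
  apply/(sortedP 0%N) => i; rewrite size_map size_iota !nthR addnS => iM /=.
  have f1 : ((m + i)%N \in u.1) = false by rewrite mem_u1; lia.
  have f2 : ((m + i).+1 \in u.1) = false by rewrite mem_u1; lia.
  by have := keyS (m + i)%N; rewrite /key f1 f2 /=; apply; lia.
exists 1, A, [seq x <- R | x != 0%N]; split.
- apply/and3P; split; last by rewrite mem_filter.
    apply/(sortedP 0%N) => i; rewrite size_map size_iota => im /=.
    have im' := ltnW im; rewrite !nthA //; have iM := leq_trans im mM.
    have /existsPn/(_ (Ordinal iM)) := h2 (Ordinal (ltnW iM)).
    rewrite eqxx !mem_u1 im im' /= => ai.
    by have := keyS i iM; rewrite /key !mem_u1 im im' leq_add2l leq_eqVlt eq_sym (negPf ai).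
  exact: sorted_filter geq_trans_ _ _ srtR.
- rewrite size_map size_iota -[X in (_ <= X)%N](subnKC mM) leq_add2l size_filter.
  by apply: leq_trans (count_size _ _) _; rewrite size_map size_iota.
move=> f _; rewrite mul1r; congr f; apply: smon_eqP => [|i] /=.
  by apply/fsetP => i; rewrite !inE /= size_map size_iota mem_iota mem_u1.
rewrite xseqE nth_cat size_map size_iota; case: ltnP => im; first by rewrite nthA.
by rewrite nth_filter_pos // nthR subnKC.
Qed.

(** * Stability and expansion on the monomial superfunctions *)

Lemma sbound_canon (u : smon) M : (sbound u <= M)%N ->
  (forall i, i \in u.1 -> (i < M)%N) /\ (forall i, (M <= i)%N -> u.2 i = 0%N).
Proof.
move=> uM; have h i : i \in u.1 `|` finsupp u.2 -> (i < M)%N.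
  by move=> iu; apply: leq_trans uM; exact: leq_bigmax_seq iu isT.
split=> i; first by move=> iu; apply: h; rewrite inE iu.
by move=> Mi; apply: fsfun_dflt; apply/negP => iu; have := h i; rewrite inE iu orbT ltnNge Mi => /(_ isT).
Qed.

Lemma stable_swap_inv N0 F :
  (forall N, (N0 <= N)%N -> swap_inv N (F N)) ->
  (forall u N, (N0 <= N)%N -> (sbound u <= N)%N -> F N u = stable N0 F u) ->
  forall M, swap_inv M (stable N0 F).
Proof.
move=> symF stF M p _; apply: functional_extensionality_dep => u; rewrite /sser_swap.
pose N := (N0 + sbound u + sbound (smon_swap p u) + p.+2)%N.
rewrite -!(stF _ N) ?/N; try lia.
transitivity (sser_swap p (F N) u) => //; rewrite symF // /N; lia.
Qed.

(** Both truncations reduce to the same canonical monomial with the same factor, and there the value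
    is 0 or 1 whatever the number of variables. *)
Lemma monoE n m (L : SPar n m) u N : (slen L <= N)%N -> (sbound u <= N)%N ->
  mono_fin N L u = mono L u.
Proof.
move=> LN uN; rewrite /mono /stable; set N' := maxn _ _.
have N'N : (N' <= N)%N by rewrite geq_max LN.
have [u1 u2] := @sbound_canon u N' (leq_maxr _ _).
have [c [A [S [cAS sz cP]]]] := canon_reduce u1 u2.
have LN' : (slen L <= N')%N by exact: leq_maxl.
rewrite !cP; last 2 first.
- exact: mono_fin_swap.
- by move=> p pN'; apply: mono_fin_swap; exact: leq_trans N'N.
by rewrite !mono_fin_canon // (leq_trans sz).
Qed.

Lemma mono_swap_inv n m (L : SPar n m) M : swap_inv M (mono L).
Proof.
apply: stable_swap_inv => [N _|u N]; first exact: mono_fin_swap.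
exact: monoE.
Qed.

Lemma sbound_le (u : smon) M : (forall i, i \in u.1 -> (i < M)%N) ->
  (forall i, (M <= i)%N -> u.2 i = 0%N) -> (sbound u <= M)%N.
Proof.
move=> u1 u2; apply/bigmax_leqP_seq => i; rewrite inE => /orP[/u1 //|iu] _.
by rewrite ltnNge; apply/negP => /u2; apply/eqP; rewrite -mem_finsupp.
Qed.

Lemma sbound_canon_le A S : (sbound (canon A S) <= size A + size S)%N.
Proof.
apply: sbound_le => i /=; first by rewrite !inE /= mem_iota /= add0n => /ltn_addr.
by move=> h; rewrite xseqE nth_default // size_cat.
Qed.

Lemma mono_canon n m (L : SPar n m) A S : is_canon A S ->
  mono L (canon A S) = ((A, S) == spar_val L)%:R.
Proof.
move=> cAS; rewrite -(@monoE _ _ _ _ (maxn (slen L) (size A + size S))) ?leq_maxl //.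
  by rewrite mono_fin_canon // ?leq_maxl ?leq_maxr.
exact: leq_trans (sbound_canon_le _ _) (leq_maxr _ _).
Qed.

(** The factor given by [canon_reduce] depends on the monomial and not on the series. It thus
    suffices to compare both sides at canonical monomials, where the [mono L] form a dual family. *)
Lemma swap_inv_expand n m (f : sser) : (forall M, swap_inv M f) ->
  (forall A S, is_canon A S -> ~~ is_spar n m (A, S) -> f (canon A S) = 0) ->
  f = \sum_(L : SPar n m) f (canon (spa L) (sps L)) *: mono L.
Proof.
move=> symf f0; apply: functional_extensionality_dep => u.
have [u1 u2] := sbound_canon (leqnn (sbound u)).
have [c [A [S [cAS sz cP]]]] := canon_reduce u1 u2.
rewrite sser_sumE (cP f (symf _)).
under eq_bigr => L _ do
  rewrite sser_scaleE (cP _ (@mono_swap_inv _ _ L _)) mono_canon // mulrCA.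
rewrite -mulr_sumr; congr (_ * _).
have [LP|LN] := boolP (is_spar n m (A, S)); last first.
  rewrite f0 // big1 // => L _; case: eqP => [e|]; last by rewrite mulr0.
  by rewrite e spar_proof in LN.
rewrite (bigD1 (MkSPar LP)) //= eqxx mulr1 big1 ?addr0 // => L nL.
by rewrite -[(A, S)]/(spar_val (MkSPar LP)) (inj_eq val_inj) eq_sym (negPf nL) mulr0.
Qed.

(** * Products of elementary superfunctions as circled 0-1 matrices *)

Definition aset N (J : {set 'I_N}) : xmon :=
  [fsfun i in [fset i in [seq val j | j <- enum J]] => 1%N].

Lemma asetE N (J : {set 'I_N}) (i : 'I_N) : aset J i = (i \in J).
Proof. by rewrite fsfunE !inE (mem_map val_inj) mem_enum; case: (i \in J). Qed.

Lemma aset_out N (J : {set 'I_N}) i : (N <= i)%N -> aset J i = 0%N.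
Proof.
move=> Ni; rewrite fsfunE !inE; case: mapP => // -[j _ ij].
by rewrite ij leqNgt ltn_ord in Ni.
Qed.

Lemma xvar_prod_aset N (J : {set 'I_N}) : \prod_(j in J) xvar j = xm (aset J).
Proof.
have [a ea aE] := xvar_prod (index_enum _) (fun j : 'I_N => j \in J) val (fun=> 1%N).
apply: etrans ea _; apply: xm_ext => i; rewrite aE.
have [iN|Ni] := ltnP i N; last first.
  rewrite aset_out // big1 // => j _; rewrite mul1n.
  by have := ltn_ord j; case: eqP => // <-; lia.
rewrite -[i]/(val (Ordinal iN)) asetE; case iJ: (_ \in J).
  rewrite (bigD1 (Ordinal iN)) //= eqxx big1 // => j /andP[_ ji].
  by rewrite -[i]/(val (Ordinal iN)) (inj_eq val_inj) eq_sym (negPf ji).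
rewrite big1 // => j jJ; rewrite -[i]/(val (Ordinal iN)) (inj_eq val_inj).
by case: eqP => // e; rewrite -e iJ in jJ.
Qed.

Definition bounded N (u : smon) : Prop :=
  (forall i, i \in u.1 -> (i < N)%N) /\ (forall i, (N <= i)%N -> u.2 i = 0%N).

(** One matrix row with k ones, and one circle when b holds. The middle condition says both that the
    exponents are at most 1 and that a circle sits on a zero. *)
Definition rowok N (b : bool) (k : nat) (v : smon) : bool :=
  [&& (\sum_(i < N) (val i \in v.1) == b)%N,
      [forall i : 'I_N, ((val i \in v.1) + v.2 i <= 1)%N]
    & (\sum_(i < N) v.2 i == k)%N].

Lemma bounded_ext N u v : bounded N u -> bounded N v ->
  (forall i : 'I_N, (val i \in u.1) = (val i \in v.1)) ->
  (forall i : 'I_N, u.2 i = v.2 i) -> u = v.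
Proof.
move=> [u1 u2] [v1 v2] e1 e2; apply: smon_eqP => [|i].
  apply/fsetP => i; have [iN|Ni] := ltnP i N; first exact: (e1 (Ordinal iN)).
  by apply/idP/idP => [/u1|/v1]; rewrite ltnNge Ni.
have [iN|Ni] := ltnP i N; first exact: (e2 (Ordinal iN)).
by rewrite u2 ?v2.
Qed.

Lemma rowok_stable M N b k v : bounded M v -> (M <= N)%N -> rowok N b k v = rowok M b k v.
Proof.
move=> [v1 v2] MN; have v1' i : (M <= i)%N -> (i \in v.1) = false.
  by move=> Mi; apply/negP => /v1; rewrite ltnNge Mi.
have widen (F : nat -> nat) : (forall i, (M <= i)%N -> F i = 0%N) ->
    (\sum_(i < N) F i = \sum_(i < M) F i)%N.
  move=> F0; rewrite (big_ord_widen N F MN) big_mkcond [RHS]big_mkcond /=.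
  by apply: eq_bigr => i _; case: ltnP => // /F0.
rewrite /rowok (widen (fun i => (i \in v.1) : nat)) ?(widen (fun i => v.2 i)) //; last first.
  by move=> i /v1' ->.
congr [&& _, _ & _]; apply/forallP/forallP => h i; first exact: (h (widen_ord MN i)).
by have [iM|Mi] := ltnP i M; [exact: (h (Ordinal iM))|rewrite v1' ?v2].
Qed.

Lemma sum_set_nat N (J : {set 'I_N}) : (\sum_(i < N) (i \in J) = #|J|)%N.
Proof. by rewrite -sum1_card [RHS]big_mkcond; apply: eq_bigr => i _; case: (i \in J). Qed.

Definition rowset N (v : smon) : {set 'I_N} := [set i : 'I_N | v.2 i == 1%N].

Lemma rowok_set N b k v (i : 'I_N) : rowok N b k v -> v.2 i = (i \in rowset N v).
Proof.
case/and3P=> _ /forallP/(_ i) vi _; rewrite inE.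
by move: vi; case: (_ \in v.1); case: (v.2 i) => [|[|x]].
Qed.

Lemma rowset_aset N (J : {set 'I_N}) S : rowset N (S, aset J) = J.
Proof. by apply/setP => i; rewrite inE asetE; case: (i \in J). Qed.

Lemma rowok_false N k v : bounded N v ->
  reflect (exists2 J : {set 'I_N}, #|J| = k & v = (fset0, aset J)) (rowok N false k v).
Proof.
move=> bv; apply: (iffP idP) => [vP|[J Jk ->]].
  exists (rowset N v).
    rewrite -sum_set_nat; have /and3P[_ _ /eqP <-] := vP.
    by apply: eq_bigr => i _; rewrite (rowok_set i vP).
  apply: (bounded_ext bv); first by split=> //= i Ni; rewrite aset_out.
    move=> i; have /and3P[/eqP h _ _] := vP; move/eqP: h.
    by rewrite sum_nat_eq0 => /forallP/(_ i) /=; case: (_ \in v.1).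
  by move=> i; rewrite asetE (rowok_set i vP).
rewrite /rowok big1 //=; under eq_bigr do rewrite asetE.
by rewrite sum_set_nat Jk eqxx andbT; apply/forallP => i; rewrite asetE; case: (i \in J).
Qed.

Lemma rowok_true N k v : bounded N v ->
  reflect (exists2 iJ : 'I_N * {set 'I_N}, (#|iJ.2| == k) && (iJ.1 \notin iJ.2)
            & v = ([fset val iJ.1], aset iJ.2)) (rowok N true k v).
Proof.
move=> bv; apply: (iffP idP) => [vP|[[i J] /= /andP[Jk iJ] ->]].
  have /and3P[/eqP h /forallP h2 _] := vP; move/eqP: h.
  move/sum_nat_eq1 => [i [_ vi vj]]; exists (i, rowset N v) => /=.
    apply/andP; split.
      rewrite -sum_set_nat; have /and3P[_ _ /eqP <-] := vP.
      by apply/eqP; apply: eq_bigr => j _; rewrite (rowok_set j vP).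
    have := h2 i; rewrite vi inE; by case: (v.2 i) => [|[]].
  apply: (bounded_ext bv).
    by split=> /= [j|j Nj]; rewrite ?aset_out // inE => /eqP ->.
    move=> j /=; rewrite inE (inj_eq val_inj); have [->|ji] := eqVneq j i.
      by case: (_ \in v.1) vi.
    by have := vj j ji isT; case: (_ \in v.1).
  by move=> j; rewrite asetE (rowok_set j vP).
rewrite /rowok; apply/and3P; split.
- rewrite (bigD1 i) //= inE eqxx big1 // => j ji.
  by rewrite inE (inj_eq val_inj) (negPf ji).
- apply/forallP => j; rewrite asetE inE (inj_eq val_inj).
  by case: eqP => [->|]; rewrite ?(negPf iJ) //; case: (j \in J).
- by under eq_bigr do rewrite asetE; rewrite sum_set_nat.
Qed.

Lemma elem_finE N k u : bounded N u -> elem_fin k N u = (rowok N false k u)%:R.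
Proof.
move=> bu; rewrite /elem_fin sser_sumE.
under eq_bigr do rewrite xvar_prod_aset.
case: rowok_false => // [[J Jk ->]|h].
  rewrite (bigD1 J) ?Jk //= /xm {1}/sdelta eqxx big1 ?addr0 // => J' /andP[_ JJ'].
  rewrite /sdelta; case: eqP => // -[e]; case/eqP: JJ'.
  by rewrite -(rowset_aset J' fset0) -e rowset_aset.
rewrite big1 // => J /eqP Jk; rewrite /xm /sdelta; case: eqP => // e.
by case: h; exists J.
Qed.

Lemma telem_finE N k u : bounded N u -> telem_fin k N u = (rowok N true k u)%:R.
Proof.
move=> bu; rewrite /telem_fin sser_sumE.
under eq_bigr => i _.
  rewrite mulr_sumr sser_sumE; under eq_bigr do rewrite xvar_prod_aset sdelta_xm.
  over.
rewrite pair_big_dep /=.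
case: rowok_true => // [[iJ iJP ->]|h].
  rewrite (bigD1 iJ) //= {1}/sdelta eqxx big1 ?addr0 // => -[i J] /andP[_ /= neq].
  rewrite /sdelta; case: eqP => // -[/fset1_inj e1 e]; case/eqP: neq.
  rewrite [iJ]surjective_pairing; congr (_, _); first exact: val_inj.
  by rewrite -(rowset_aset J fset0) -e rowset_aset.
rewrite big1 // => iJ iJP; rewrite /sdelta; case: eqP => // e.
by case: h; exists iJ.
Qed.

(** * Coefficients of products of elementary factors *)

Definition fac (r : bool * nat) : sser := if r.1 then telem r.2 else elem r.2.

Lemma bounded_sbound u N : (sbound u <= N)%N -> bounded N u.
Proof. exact: sbound_canon. Qed.

Lemma facE N r u : bounded N u -> fac r u = (rowok N r.1 r.2 u)%:R.
Proof.
move=> [u1 u2]; have uN := sbound_le u1 u2.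
have bu := bounded_sbound (leqnn (sbound u)).
rewrite (rowok_stable _ _ bu uN) /fac; case: r => -[] k /=.
  by rewrite /telem /stable max0n telem_finE.
by rewrite /elem /stable max0n elem_finE.
Qed.

Lemma fac_swap_inv r M : swap_inv M (fac r).
Proof.
move=> p _; apply: functional_extensionality_dep => u; rewrite /sser_swap.
pose N := (sbound u + sbound (smon_swap p u) + p.+2)%N.
have bu : bounded N u by apply: bounded_sbound; rewrite /N; lia.
have bs : bounded N (smon_swap p u) by apply: bounded_sbound; rewrite /N; lia.
have pN : (p.+1 < N)%N by rewrite /N; lia.
rewrite !(@facE N) //; pose P : 'I_N := Ordinal (ltnW pN); pose Q : 'I_N := Ordinal pN.
have tE (i : 'I_N) : nswap p i = tperm P Q i.
  case: tpermP => [->|->|/eqP nP /eqP nQ] /=; first by rewrite /nswap eqxx.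
    by rewrite /nswap (gtn_eqF (ltnSn p)) eqxx.
  by rewrite /nswap -[p]/(val P) -[p.+1]/(val Q) !val_eqE (negPf nP) (negPf nQ).
have -> : rowok N r.1 r.2 (smon_swap p u) = rowok N r.1 r.2 u.
  rewrite /rowok; congr [&& _, _ & _].
  - congr (_ == _); rewrite [RHS](reindex_inj (@perm_inj _ (tperm P Q))) /=.
    by apply: eq_bigr => i _; rewrite mem_fset_swap tE.
  - apply/forallP/forallP => h i; have := h (tperm P Q i).
      by rewrite mem_fset_swap xmon_swapE !tE tpermK.
    by rewrite mem_fset_swap xmon_swapE !tE.
  - congr (_ == _); rewrite [RHS](reindex_inj (@perm_inj _ (tperm P Q))) /=.
    by apply: eq_bigr => i _; rewrite xmon_swapE tE.
(* A row carries at most one circle, so p and p + 1 are not both fermionic and the sign is 1. *)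
have [/and3P[/eqP u1 _ _]|] := boolP (rowok _ _ _ _); last by rewrite mulr0.
rewrite /swap_sign -[p]/(val P) -[X in _ && (X \in _)]/(val Q) mulr1.
move: u1; rewrite (bigD1 P) //= (bigD1 Q) //=; last by rewrite -val_eqE /=; lia.
by case: (p \in _); case: (p.+1 \in _) => //=; case: (r.1); lia.
Qed.

Lemma fac_prod_swap_inv rs M : swap_inv M (\prod_(r <- rs) fac r).
Proof.
move=> p pM; rewrite rmorph_prod; apply: eq_bigr => r _ /=.
exact: fac_swap_inv pM.
Qed.

Lemma fac_prod_int rs u : (\prod_(r <- rs) fac r) u \is a Num.int.
Proof.
elim: rs u => [|r rs IHrs] u.
  by rewrite big_nil (_ : (1 : sser) = sdelta smon1) // /sdelta; case: eqP.
rewrite big_cons sser_mulE rpred_sum // => v _; rewrite !rpredM ?rpredX ?rpredN1 ?rpred1 //.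
rewrite (@facE (sbound v)); last exact: bounded_sbound.
by case: (rowok _ _ _ _).
Qed.

(** The matrix is stored by rows, each being a monomial of the corresponding factor. The last two
    conditions prescribe the column sums and the columns holding a circle. *)
Definition filling N (rs : seq (bool * nat)) (u : smon) (vs : seq smon) : Prop :=
  [/\ size vs = size rs,
      forall k, (k < size rs)%N -> rowok N (nth (false, 0%N) rs k).1 (nth (false, 0%N) rs k).2 (nth smon1 vs k),
      forall i, (\sum_(v <- vs) v.2 i = u.2 i)%N
    & forall i, (\sum_(v <- vs) (i \in v.1) = (i \in u.1))%N].

Lemma squo_bounded N u v : bounded N u -> bounded N (squo u v).
Proof.
move=> [u1 u2]; split=> [i|i /u2 ui]; last by rewrite xmonBE ui.
by rewrite in_fsetD => /andP[_ /u1].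
Qed.

Lemma sdivs_bounded N u v : bounded N u -> v \in sdivs u -> bounded N v.
Proof.
move=> [u1 u2] /sdvdP[/fsubsetP le1 le2]; split=> [i /le1/u1 //|i /u2 ui].
by apply/eqP; rewrite -leqn0; have := le2 i; rewrite ui.
Qed.

(** Follows the recursion of [sser_mul]: the first row is a divisor of u and the other rows fill the
    quotient. *)
Lemma filling_cons N r rs u v vs :
  filling N (r :: rs) u (v :: vs) <->
  [/\ v \in sdivs u, rowok N r.1 r.2 v & filling N rs (squo u v) vs].
Proof.
split=> [[[sz] ok s2 s1]|[vu vok [sz ok s2 s1]]]; last first.
  have /sdvdP[/fsubsetP le1 le2] := vu; split=> [|[|k]|i|i] //=; first by rewrite sz.
  - exact: ok.
  - by rewrite big_cons s2 xmonBE subnKC.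
  - rewrite big_cons s1 in_fsetD; have := le1 i.
    by case: (i \in v.1) => //= ->.
have le1 i : i \in v.1 -> i \in u.1.
  by move=> iv; have := s1 i; rewrite big_cons iv; case: (i \in u.1).
have le2 i : (v.2 i <= u.2 i)%N by rewrite -s2 big_cons leq_addr.
split; first by apply/sdvdP; split=> //; apply/fsubsetP.
  exact: (ok 0%N).
split=> // [k|i|i]; first exact: (ok k.+1).
  by rewrite xmonBE -s2 big_cons addKn.
rewrite in_fsetD; have := s1 i; rewrite big_cons.
by case: (i \in v.1); case: (i \in u.1) => //= -[].
Qed.

Lemma filling0 N u vs : filling N [::] u vs <-> u = smon1 /\ vs = [::].
Proof.
split=> [[/size0nil -> _ s2 s1]|[-> ->]]; last first.
  by split=> // i; rewrite big_nil ?xmon1E ?in_fset0.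
split=> //; apply: smon_eqP => [|i]; last by rewrite -s2 big_nil xmon1E.
by apply/fsetP => i; have := s1 i; rewrite big_nil in_fset0; case: (i \in u.1).
Qed.

Lemma fac_prod_neq0 N rs u : bounded N u ->
  (\prod_(r <- rs) fac r) u != 0 -> exists vs, filling N rs u vs.
Proof.
elim: rs u => [|r rs IHrs] u bu.
  rewrite big_nil (_ : (1 : sser) = sdelta smon1) // /sdelta.
  case: (u =P smon1) => // -> _; exists [::].
  exact/filling0.
rewrite big_cons sser_mulE => nz.
have [|/hasPn h] := boolP (has (fun v : smon => (-1) ^+ sinv v.1 (squo u v).1 * fac r v *
  (\prod_(j <- rs) fac j) (squo u v) != 0) (sdivs u)); last first.
  by case/eqP: nz; rewrite big_seq big1 // => v /h /negbNE /eqP.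
move=> /hasP[v vu]; rewrite !mulf_eq0 !negb_or => /andP[/andP[_ fv]].
move=> /(IHrs _ (squo_bounded v bu))[vs vsP]; exists (v :: vs); apply/filling_cons.
have bv := sdivs_bounded bu vu.
by split=> //; move: fv; rewrite (facE _ bv); case: (rowok _ _ _ _).
Qed.

Definition before (v w : smon) : bool := all (fun i => all (fun j => i < j)%N w.1) v.1.

(** A single filling leaves a single term in the convolution, and circles moving strictly to the
    right from row to row create no inversion, so this term is 1. *)
Lemma fac_prod_uniq N rs u vs : bounded N u -> filling N rs u vs ->
  (forall ws, filling N rs u ws -> ws = vs) -> pairwise before vs ->
  (\prod_(r <- rs) fac r) u = 1.
Proof.
elim: rs u vs => [|r rs IHrs] u vs bu.
  by move=> /filling0[-> _] _ _; rewrite big_nil (_ : (1 : sser) = sdelta smon1) // /sdelta eqxx.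
case: vs => [[] //|v vs] /filling_cons[vu vok vsP] vs_uniq /= /andP[v_bef vs_bef].
have bq := squo_bounded v bu.
have bv w : w \in sdivs u -> bounded N w by exact: sdivs_bounded.
rewrite big_cons sser_mulE (bigD1_seq v) ?fset_uniq //= (IHrs _ vs) //; last first.
  move=> ws wsP; have : filling N (r :: rs) u (v :: ws) by apply/filling_cons.
  by move=> /vs_uniq[].
rewrite (facE _ (bv v vu)) vok !mulr1 big_seq_cond big1 ?addr0 => [|w /andP[wu wv]].
  suff -> : sinv v.1 (squo u v).1 = 0%N by [].
  rewrite /sinv big_seq big1 // => i iv; rewrite big_seq big1 // => j jq.
  suff : (i < j)%N by case: ltngtP.
  (* A theta of the quotient belongs to some later row, whose circles lie to the right of those of
     v. *)
  have [_ _ _ /(_ j)] := vsP; rewrite jq; case: (boolP (has (fun w : smon => j \in w.1) vs)).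
    move=> /hasP[w wvs jw] _; have /allP/(_ w wvs) := v_bef.
    by move=> /allP/(_ i iv)/allP/(_ j jw).
  move=> /hasPn h; rewrite big_seq big1 // => w /h /negPf -> //.
apply/eqP/negP => /negP; rewrite !mulf_eq0 !negb_or => /andP[/andP[_ fw]].
move=> /(fac_prod_neq0 (squo_bounded w bu))[ws wsP].
have : filling N (r :: rs) u (w :: ws).
  apply/filling_cons; split=> //; move: fw; rewrite (facE _ (bv w wu)).
  by case: (rowok _ _ _ _).
by move=> /vs_uniq[wv']; rewrite wv' eqxx in wv.
Qed.

(** Replacing a divisor v of u by the quotient of u by v matches the terms of both products. Each
    factor has exactly one theta, so the inversion number switches between 0 and 1. *)
Lemma telem_anticomm a b : telem a * telem b = - (telem b * telem a).
Proof.
apply: functional_extensionality_dep => u.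
rewrite (_ : (- (telem b * telem a)) u = - (telem b * telem a) u) // !sser_mulE.
have qK v : v \in sdivs u -> squo u v \in sdivs u /\ squo u (squo u v) = v.
  move=> vu; have [_ e] := squo_divs (smon_div u) vu.
  have /sdvdP[/fsubsetP le1 le2] := vu; split.
    apply/sdvdP; split=> [|i]; first exact: fsubsetDl.
    by rewrite xmonBE leq_subr.
  apply: smon_eqP => [|i]; last by rewrite !xmonBE subKn.
  apply/fsetP => i; rewrite !in_fsetD negb_and negbK; have := le1 i.
  by case: (i \in v.1) => [/(_ isT) ->|_] //=; case: (i \in u.1).
have pE : perm_eq (sdivs u) [seq squo u v | v <- sdivs u].
  apply: uniq_perm; rewrite ?fset_uniq //.
    rewrite map_inj_in_uniq ?fset_uniq // => v w /qK[_ {2}<-] /qK[_ {2}<-] -> //.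
  move=> v; apply/idP/mapP => [/qK[qu e]|[w /qK[wu _] ->] //]; exists (squo u v) => //.
rewrite (perm_big _ pE) big_map big_seq [in RHS]big_seq -sumrN; apply: eq_bigr => v vu.
have [qu ->] := qK v vu; set w := squo u v.
have bd x : bounded (sbound x) x by exact: bounded_sbound.
rewrite -[telem a]/(fac (true, a)) -[telem b]/(fac (true, b)).
rewrite (facE (true, a) (bd w)) (facE (true, b) (bd v)).
case: rowok_true => //; last by rewrite mulr0 mul0r mulr0 oppr0.
move=> [[i I] _ ew]; case: rowok_true => //; last by rewrite !mulr0 mul0r oppr0.
move=> [[j J] _ ev].
have w1 : w.1 = [fset val i] := congr1 fst ew.
have v1 : v.1 = [fset val j] := congr1 fst ev.
have ij : val i != val j.
  have := fdisjointDr_ v.1 u.1; rewrite -[u.1 `\` v.1]/(w.1) w1 v1.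
  by rewrite fdisjointX1 inE.
rewrite !mulr1 w1 v1 /sinv !big_seq_fset1.
by case: ltngtP ij => //= _ _; rewrite expr0 expr1 ?opprK.
Qed.

(** * Conjugation and triangularity *)

Section Conjugate.
Variables (n m : nat) (L L' : SPar n m).
Hypothesis conjL : is_conjugate L L'.

Lemma conj_col_len j : (nth (0%N, false) (circled L') j).1 = col_len L j.
Proof.
have le_lt (a b : nat) : (forall i, (i < a) = (i < b))%N -> (a <= b)%N.
  by move=> h; rewrite leqNgt h ltnn.
have h i : (i < (nth (0%N, false) (circled L') j).1 = (i < col_len L j))%N.
  by have [] := conjL j i; rewrite (dboxE L) /dbox.
by apply/eqP; rewrite eqn_leq !le_lt.
Qed.

Lemma size_circled (M : SPar n m) : size (circled M) = slen M.
Proof.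
have [sza _ _ _ _] := sparP M.
by rewrite (perm_size (circled_perm M)) size_cat !size_map sza.
Qed.

Lemma conj_comp_plus N (j : 'I_N) : (slen L' <= N)%N ->
  tnth (comp_plus (spar_comp N L')) j = col_len L j.
Proof.
move=> LN; rewrite -conj_col_len (tnth_nth 0%N) /=.
have -> : sort geq (spar_comp N L') =
    map fst (circled L') ++ nseq (N - slen L') 0%N.
  apply: (sorted_eq geq_trans_).
  - by move=> x y /andP[/= xy yx]; apply/eqP; rewrite eqn_leq yx xy.
  - by apply: sort_sorted => x y /=; exact: leq_total.
  - rewrite (sorted_pairwise geq_trans_) pairwise_cat -!(sorted_pairwise geq_trans_).
    rewrite fst_circled_sorted ?circled_sorted //=; apply/andP; split.
      by apply/allrelP => x y _ /nseqP[-> _].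
    by elim: (N - _)%N => [|[|k] IHk].
  rewrite perm_sort spar_comp_pad // perm_cat2r perm_sym.
  apply: perm_trans (perm_map fst (circled_perm L')) _.
  by rewrite map_cat -!map_comp !map_id_in.
rewrite nth_cat size_map size_circled; case: ltnP => h.
  by rewrite (nth_map (0%N, false)) // size_circled.
by rewrite nth_nseq if_same nth_default // size_circled.
Qed.

Lemma col_len_lt k k' : k' \in spa L ++ sps L -> (k < k')%N -> (col_len L k' < col_len L k)%N.
Proof.
move=> + kk; rewrite /col_len; elim: (_ ++ _) => //= x s IHs.
have le_s : (count (fun x => k' < x) s <= count (fun x => k < x) s)%N.
  by apply: sub_count => y; exact: ltn_trans.
rewrite inE => /predU1P[<-|/IHs{}IHs]; first by rewrite ltnn kk add0n add1n ltnS.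
rewrite -addnS; apply: leq_add => //.
by case k'x: (k' < x)%N => //; rewrite (ltn_trans kk k'x).
Qed.

(** Transposition sends the circle at the end of a row of length k to the end of column k. Longer
    rows give strictly shorter columns, hence the reversal. *)
Lemma conj_spa : spa L' = [seq col_len L k | k <- rev (spa L)].
Proof.
have [sza srta _ _ _] := sparP L; have [_ srta' _ _ _] := sparP L'.
apply: (@irr_sorted_eq _ gtn) => //=.
- by move=> y x z /= yx zy; exact: ltn_trans zy yx.
- by move=> x /=; rewrite ltnn.
- rewrite sorted_map rev_sorted.
  apply: (sub_in_sorted (P := mem (spa L)) _ _ srta); last exact/allP.
  move=> k k' ka k'a /= kk; apply: col_len_lt => //; rewrite mem_cat; by rewrite (k'a, ka).
move=> a; apply/idP/mapP => [aL|[k]].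
  have [_] := conjL (col_len L' a) a.
  rewrite (dcircleE L) (dcircleE L') aL eqxx /= => /esym/andP[kL /eqP ak].
  by exists (col_len L' a); rewrite ?mem_rev.
rewrite mem_rev => kL ->; have [_] := conjL k (col_len L k).
by rewrite (dcircleE L) (dcircleE L') kL eqxx => /andP[].
Qed.

Lemma leq_conj_slen k : k \in spa L ++ sps L -> (k <= slen L')%N.
Proof.
move=> kL; case: k kL => // k kL; rewrite -size_circled ltnNge; apply/negP => h.
have := col_len_lt kL (ltnSn k); rewrite -[col_len L k]conj_col_len nth_default //.
Qed.

End Conjugate.

(** * Constraints on the matrices of a given product *)

Lemma sumn_take_tuple N (t : N.-tuple nat) k : (k <= N)%N ->
  sumn (take k t) = (\sum_(j < N | j < k) tnth t j)%N.
Proof.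
move=> kN; rewrite -(@map_nth_iota0 _ 0%N) ?size_tuple // sumnE big_map.
rewrite -[X in iota 0 X]subn0 -/(index_iota 0 k) big_mkord (big_ord_widen N (fun i => nth 0%N t i) kN).
by apply: eq_bigr => j _; rewrite (tnth_nth 0%N).
Qed.

Lemma eq_leq_sum (I : finType) (F G : I -> nat) :
  (forall i, F i <= G i)%N -> (\sum_i F i = \sum_i G i)%N -> F =1 G.
Proof.
move=> FG e i.
have [_] := @leqif_sum I xpredT (fun i => F i == G i) F G (fun i _ => leqif_eq (FG i)).
by rewrite e eqxx => /esym/forallP/(_ i)/eqP.
Qed.

Definition rows n m (L : SPar n m) : seq (bool * nat) :=
  [seq (true, k) | k <- rev (spa L)] ++ [seq (false, k) | k <- sps L].

Lemma size_rows n m (L : SPar n m) : size (rows L) = slen L.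
Proof.
have [sza _ _ _ _] := sparP L.
by rewrite size_cat !size_map size_rev sza.
Qed.

Lemma nth_rows1 n m (L : SPar n m) k : (nth (false, 0%N) (rows L) k).1 = (k < m)%N.
Proof.
have [sza _ _ _ _] := sparP L.
rewrite nth_cat size_map size_rev sza; case: ltnP => km.
  by rewrite (nth_map 0%N) // size_rev sza.
have [h|h] := ltnP (k - m) (size (sps L)); first by rewrite (nth_map 0%N).
by rewrite nth_default // size_map.
Qed.

Lemma rows_col_len n m (L : SPar n m) j :
  (\sum_(k < slen L) (j < (nth (false, 0%N) (rows L) k).2) = col_len L j)%N.
Proof.
rewrite -size_rows -(big_mkord xpredT (fun k => (j < (nth (false, 0%N) (rows L) k).2 : nat)%N)).
rewrite -(big_nth (false, 0%N) xpredT (fun r => (j < r.2)%N : nat)) /rows big_cat !big_map /=.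
have sumE (s : seq nat) : (\sum_(k <- s) (j < k) = count (fun x => j < x) s)%N.
  by rewrite -sum1_count [RHS]big_mkcond; apply: eq_bigr => k _ /=; case: ltnP.
by rewrite !sumE count_rev -count_cat.
Qed.

(** Pigeonhole: the indices from j on would inject into those strictly above j. *)
Lemma no_shifted_injection m (f : 'I_m -> 'I_m) (j : 'I_m) :
  injective f -> (forall r : 'I_m, j <= r -> j < f r)%N -> False.
Proof.
move=> inj_f fj; pose X := [set r : 'I_m | (j <= r)%N].
have : (#|f @: X| < #|X|)%N.
  apply: proper_card; apply/properP; split.
    by apply/subsetP => q /imsetP[r + ->]; rewrite !inE => /fj/ltnW.
  exists j; first by rewrite inE.
  by apply/imsetP => -[r + e]; rewrite inE => /fj; rewrite -e ltnn.
by rewrite card_imset ?ltnn.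
Qed.

Section Triangular.
Variables (n m : nat) (L L' : SPar n m).
Hypothesis conjL : is_conjugate L L'.
Variables (N : nat) (A S : seq nat) (vs : seq smon).
Hypotheses (LN : (slen L' <= N)%N) (ASN : (size A + size S <= N)%N).
Hypothesis cAS : is_canon A S.
Hypothesis vsP : filling N (rows L) (canon A S) vs.

Let R k := (nth (false, 0%N) (rows L) k).2.
Let V k := nth smon1 vs k.
Let t : N.-tuple nat := [tuple nth 0%N (A ++ S) i | i < N].
Let t' := spar_comp N L'.
Let w := comp_perm t.

Let Vok k : (k < slen L)%N -> rowok N (k < m)%N (R k) (V k).
Proof. by move=> kL; have [_ + _ _] := vsP; rewrite size_rows => /(_ k kL); rewrite nth_rows1. Qed.

Let sumV2 (i : 'I_N) : (\sum_(k < slen L) (V k).2 i = tnth t i)%N.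
Proof.
have [sz _ + _] := vsP => /(_ i); rewrite (big_nth smon1) sz size_rows big_mkord.
by rewrite tnth_mktuple /= xseqE.
Qed.

Let sumV1 i : (\sum_(k < slen L) (i \in (V k).1) = (i < size A))%N.
Proof.
have [sz _ _ +] := vsP => /(_ i); rewrite (big_nth smon1) sz size_rows big_mkord => ->.
by rewrite !inE /= mem_iota.
Qed.

(** Counting the circles, then the ones, by rows and by columns gives the two degrees. *)
Lemma filling_spar : is_spar n m (A, S).
Proof.
have [sza _ _ _ sumE] := sparP L.
have mN : (m <= slen L)%N by exact: leq_addr.
have szA : size A = m.
  have : (\sum_(i < N) \sum_(k < slen L) (val i \in (V k).1) = m)%N.
    rewrite exchange_big /= (eq_bigr (fun k : 'I_(slen L) => (k < m : nat)%N)); last first.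
      by move=> k _; have /and3P[/eqP] := Vok (ltn_ord k).
    by rewrite -big_mkcond /= sum1_card -sum1_card (big_ord_narrow mN) sum1_card card_ord.
  under eq_bigr do rewrite sumV1.
  have AN : (size A <= N)%N by apply: leq_trans ASN; exact: leq_addr.
  by rewrite -big_mkcond /= (big_ord_narrow AN) sum1_card card_ord.
have sumAS : (sumn A + sumn S)%N = n.
  have : (\sum_(i < N) tnth t i = n)%N.
    under eq_bigr do rewrite -sumV2.
    rewrite exchange_big /= (eq_bigr (fun k : 'I_(slen L) => R k)); last first.
      by move=> k _; have /and3P[_ _ /eqP] := Vok (ltn_ord k).
    rewrite -(big_mkord xpredT R) -size_rows /R -(big_nth (false, 0%N) xpredT (fun r => r.2)).
    by rewrite /rows big_cat !big_map -!sumnE sumn_rev.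
  rewrite -sumn_cat => <-; have := sumn_take_tuple t (leqnn N).
  rewrite take_oversize ?size_tuple // tuple_pad ?size_cat // sumn_cat sumn_nseq mul0n addn0 => ->.
  by apply: eq_bigl => j; rewrite ltn_ord.
have /and3P[srtA srtS S0] := cAS.
by apply/and5P; rewrite szA srtA srtS S0 sumAS !eqxx.
Qed.

Let szA : size A = m.
Proof. by have /and5P[/eqP] := filling_spar. Qed.

(** A 0-1 row of sum [R r] has at most min(k, R r) ones in any k columns, and the right-hand side
    equals this minimum. Summed over the rows, this is the easy half of the Gale-Ryser theorem. *)
Let row_prefix k r : (r < slen L)%N -> (k <= N)%N ->
  (\sum_(j < N | j < k) (V r).2 (w j) <= \sum_(j < N | j < k) (j < R r))%N.
Proof.
move=> rL kN; have Vr := Vok rL.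
have le1 (i : 'I_N) : ((V r).2 i <= 1)%N by rewrite (rowok_set i Vr); case: (_ \in _).
have [kR|/ltnW Rk] := leqP k (R r).
  by apply: leq_sum => j jk; rewrite (leq_trans jk kR) le1.
have RN := leq_trans Rk kN.
rewrite [leqRHS](_ : _ = R r).
  have /and3P[_ _ /eqP <-] := Vr; rewrite [leqRHS](reindex_inj (@perm_inj _ w)) /=.
  by rewrite [leqRHS](bigID (fun j : 'I_N => (j < k)%N)) /= leq_addr.
rewrite -big_mkcondr /= (eq_bigl (fun j : 'I_N => (j < R r)%N)).
  by rewrite (big_ord_narrow RN) sum1_card card_ord.
by move=> j /=; case: (ltnP j (R r)) => [h|]; rewrite ?andbF // (leq_trans h Rk).
Qed.

Let prefix_t k : (\sum_(j < N | j < k) tnth (comp_plus t) j =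
  \sum_(r < slen L) \sum_(j < N | j < k) (V r).2 (w j))%N.
Proof.
rewrite exchange_big /=; apply: eq_bigr => j _.
by rewrite -comp_perm_tnth -sumV2.
Qed.

Let prefix_t' k : (\sum_(j < N | j < k) tnth (comp_plus t') j =
  \sum_(r < slen L) \sum_(j < N | j < k) (j < R r))%N.
Proof.
rewrite exchange_big /=; apply: eq_bigr => j _.
by rewrite (conj_comp_plus conjL) // -rows_col_len.
Qed.

Lemma filling_dominance : dominance (comp_plus t) (comp_plus t').
Proof.
apply/forallP => k; have kN : (k <= N)%N by rewrite -ltnS.
rewrite !sumn_take_tuple // prefix_t prefix_t'.
by apply: leq_sum => r _; exact: row_prefix.
Qed.

Hypothesis plusE : comp_plus t = comp_plus t'.

(** When the sorted column sums agree, the prefix inequalities of all rows add up to an equality, so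
    each is an equality. Subtracting consecutive prefixes gives the entries. *)
Let V2E r (j : 'I_N) : (r < slen L)%N -> (V r).2 (w j) = (j < R r)%N.
Proof.
move=> rL; have prefE k : (k <= N)%N ->
    (\sum_(j < N | j < k) (V r).2 (w j) = \sum_(j < N | j < k) (j < R r))%N.
  move=> kN; pose F (r : 'I_(slen L)) := (\sum_(j < N | (j < k)%N) (V r).2 (w j))%N.
  pose G (r : 'I_(slen L)) := (\sum_(j < N | (j < k)%N) (j < R r))%N.
  have FG i : (F i <= G i)%N by apply: row_prefix.
  have := eq_leq_sum FG; rewrite -prefix_t -prefix_t' plusE => /(_ erefl (Ordinal rL)).
  by [].
have splitj (H : 'I_N -> nat) : (\sum_(i < N | i < j.+1) H i = H j + \sum_(i < N | i < j) H i)%N.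
  rewrite (bigD1 j) //=; congr (_ + _)%N; apply: eq_bigl => i.
  by rewrite ltnS ltn_neqAle andbC.
have := prefE j.+1 (ltn_ord j); rewrite !splitj (prefE j (ltnW (ltn_ord j))).
by move/addIn.
Qed.

Let V2Ei r (i : 'I_N) : (r < slen L)%N -> (V r).2 i = ((w^-1)%g i < R r)%N.
Proof. by move=> rL; rewrite -V2E // permKV. Qed.

Let mL : (m <= slen L)%N. Proof. exact: leq_addr. Qed.

(** [f r] is the column of the circle of row r; it is injective since a column holds at most one
    circle. The circle sits on a zero, so its sorted position is at least [R r] and its column is at
    most as long as [col_len L (R r)], the entry number r of [spa L']. *)
Lemma filling_circles : exists f : 'I_m -> 'I_m,
  [/\ injective f, forall r : 'I_m, (V r).1 = [fset val (f r)]
    & forall r : 'I_m, (nth 0%N A (f r) <= nth 0%N (spa L') r)%N].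
Proof.
have mN : (m <= N)%N by rewrite -szA (leq_trans _ ASN) ?leq_addr.
have VB r : (r < slen L)%N -> bounded N (V r).
  move=> rL; split=> [i iV|i Ni].
    have := sumV1 i; rewrite (bigD1 (Ordinal rL)) //= iV szA => h.
    by apply: leq_trans mN; case: ltnP h => //=.
  have [sz _ /(_ i) + _] := vsP; rewrite (big_nth smon1) sz size_rows big_mkord.
  rewrite /= xseqE nth_default ?size_cat ?(leq_trans ASN) // => /eqP.
  by rewrite sum_nat_eq0 => /forallP/(_ (Ordinal rL))/eqP.
have exf (r : 'I_m) : exists i : 'I_m, (V r).1 = [fset val i] /\ (nth 0%N A i <= nth 0%N (spa L') r)%N.
  have rL := leq_trans (ltn_ord r) mL.
  have := Vok rL; rewrite ltn_ord => /(rowok_true _ (VB r rL))[[i J] /= /andP[_ iJ] VE].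
  have im : (i < m)%N.
    have := sumV1 i; rewrite (bigD1 (Ordinal rL)) //= VE inE eqxx szA.
    by case: ltnP.
  exists (Ordinal im); split; first by rewrite VE.
  have [sza _ _ _ _] := sparP L.
  have iw : (R r <= (w^-1)%g i)%N.
    by rewrite leqNgt; move: iJ; apply: contra => h; have := V2Ei i rL; rewrite VE /= asetE h; case: (_ \in J).
  have RN : (R r < N)%N by apply: leq_ltn_trans iw _.
  have -> : nth 0%N A (Ordinal im) = tnth t i by rewrite tnth_mktuple nth_cat szA im.
  have -> : nth 0%N (spa L') r = col_len L (R r).
    rewrite (conj_spa conjL) (nth_map 0%N) ?size_rev ?sza // /R /rows nth_cat size_map size_rev sza ltn_ord.
    by rewrite (nth_map 0%N) // size_rev sza.
  have -> : tnth t i = tnth (comp_plus t) ((w^-1)%g i) by rewrite -comp_perm_tnth permKV.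
  rewrite -[R r]/(val (Ordinal RN)) -(conj_comp_plus conjL) // plusE.
  exact: comp_plus_anti.
have [f fP] := choice exf; exists f; split=> [r r' e|r|r]; try by case: (fP r).
apply/eqP/negP => /negP rr'; have := sumV1 (f r).
rewrite (bigD1 (widen_ord mL r)) //= (fP r).1 inE eqxx (bigD1 (widen_ord mL r')) /=; last first.
  by rewrite -val_eqE /= eq_sym.
by rewrite (fP r').1 e inE eqxx; case: (_ < _)%N.
Qed.

Lemma filling_spa_le i : (i < m)%N -> (nth 0%N A i <= nth 0%N (spa L') i)%N.
Proof.
move=> im; have [f [inj_f _ fP]] := filling_circles.
have /and3P[srtA _ _] := cAS; have [sza' srta' _ _ _] := sparP L'.
have anti (s : seq nat) j k : sorted gtn s -> (j <= k)%N -> (k < size s)%N ->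
    (nth 0%N s k <= nth 0%N s j)%N.
  move=> srt jk ks.
  have srt' : sorted geq s by apply: sub_sorted srt => x y /ltnW.
  apply: (sorted_leq_nth geq_trans_ (leqnn : reflexive geq) 0%N srt') => //.
  by rewrite inE (leq_ltn_trans jk).
rewrite leqNgt; apply/negP => lt_i.
(* If A_i exceeds Lambda'_i, then for r from i on, A_(f r) is at most Lambda'_r, hence below A_i. As
   A decreases, f r is strictly above i. *)
apply: (@no_shifted_injection _ f (Ordinal im) inj_f) => r /= ir.
rewrite ltnNge; apply/negP => fi.
have h1 : (nth 0%N A i <= nth 0%N A (f r))%N by apply: anti; rewrite // szA.
have h2 : (nth 0%N (spa L') r <= nth 0%N (spa L') i)%N by apply: anti; rewrite // sza'.
by have := fP r; lia.
Qed.

(** With A equal to the fermionic part of Lambda', the bounds on the circles say that f r is at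
    least r, since A is strictly decreasing. The injection f is therefore the identity. *)
Lemma filling_top : A = spa L' -> forall r, (r < slen L)%N ->
  V r = (if (r < m)%N then [fset r] else fset0, aset [set i : 'I_N | ((w^-1)%g i < R r)%N]).
Proof.
move=> eA r rL; have [f [inj_f f1 fP]] := filling_circles.
have ge_f (k : 'I_m) : (k <= f k)%N.
  rewrite leqNgt; apply/negP => fk; have := fP k; rewrite -eA leqNgt => /negP; apply.
  have /and3P[srtA _ _] := cAS.
  apply: (sorted_ltn_nth (leT := gtn) _ 0%N srtA) => //; rewrite ?inE ?szA //.
  by move=> y x z /= yx zy; exact: ltn_trans zy yx.
have fE (k : 'I_m) : f k = k.
  apply/val_inj/eqP; rewrite eqn_leq ge_f andbT leqNgt; apply/negP => kf.
  apply: (no_shifted_injection (j := k) inj_f) => q; rewrite leq_eqVlt => /predU1P[/val_inj <- //|].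
  by move/leq_trans; apply.
apply: smon_eqP => [|i] /=.
  case: ltnP => rm; first by have := f1 (Ordinal rm); rewrite fE.
  have /and3P[+ _ _] := Vok rL; rewrite ltnNge rm sum_nat_eq0 => /forallP h.
  apply/fsetP => i; rewrite inE; apply/negP => iV.
  have iN : (i < N)%N.
    have := sumV1 i; rewrite (bigD1 (Ordinal rL)) //= iV => h'.
    by apply: leq_trans ASN; apply: leq_trans (leq_addr _ _); case: ltnP h' => //.
  by have := h (Ordinal iN); rewrite /= iV.
have [iN|Ni] := ltnP i N.
  by rewrite -[i]/(val (Ordinal iN)) asetE inE V2Ei.
rewrite aset_out //; have [sz _ /(_ i) + _] := vsP.
rewrite (big_nth smon1) sz size_rows big_mkord.
rewrite /= xseqE nth_default ?size_cat ?(leq_trans ASN) // => /eqP.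
by rewrite sum_nat_eq0 => /forallP/(_ (Ordinal rL))/eqP.
Qed.

End Triangular.

(** Row r of the Ferrers diagram of Lambda, with columns rearranged so that their lengths read
    Lambda'^c, and a circle in column r for a fermionic row. *)
Definition top_row n m (L L' : SPar n m) N r : smon :=
  (if (r < m)%N then [fset r] else fset0,
   aset [set i : 'I_N | (((comp_perm (spar_comp N L'))^-1)%g i
                         < (nth (false, 0%N) (rows L) r).2)%N]).

Definition top_filling n m (L L' : SPar n m) N : seq smon :=
  [seq top_row L L' N r | r <- iota 0 (slen L)].

Section TopFilling.
Variables (n m : nat) (L L' : SPar n m) (N : nat).
Hypotheses (conjL : is_conjugate L L') (LN : (slen L' <= N)%N).

Let R k := (nth (false, 0%N) (rows L) k).2.
Let t' := spar_comp N L'.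
Let w := comp_perm t'.

Let colE (i : 'I_N) : tnth t' i = col_len L ((w^-1)%g i).
Proof. by rewrite -(conj_comp_plus conjL) // -comp_perm_tnth permKV. Qed.

Let mN : (m <= N)%N.
Proof. by apply: leq_trans LN; exact: leq_addr. Qed.

Lemma mem_rows r : (r < slen L)%N -> R r \in spa L ++ sps L.
Proof.
rewrite -size_rows => rL; have : R r \in [seq x.2 | x <- rows L].
  by apply: map_f; exact: mem_nth.
by rewrite /rows map_cat -!map_comp !map_id_in // !mem_cat mem_rev.
Qed.

Lemma nth_conj_spa r : (r < m)%N -> nth 0%N (spa L') r = col_len L (R r).
Proof.
have [sza _ _ _ _] := sparP L; move=> rm.
rewrite (conj_spa conjL) (nth_map 0%N) ?size_rev ?sza // /R /rows nth_cat size_map size_rev sza rm.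
by rewrite (nth_map 0%N) // size_rev sza.
Qed.

Lemma top_filling_ok : filling N (rows L) (canon (spa L') (sps L')) (top_filling L L' N).
Proof.
have [sza' _ _ _ _] := sparP L'.
have big_top (F : smon -> nat) :
    (\sum_(v <- top_filling L L' N) F v = \sum_(r < slen L) F (top_row L L' N r))%N.
  by rewrite big_map -[X in iota 0 X]subn0 -/(index_iota 0 _) big_mkord.
split=> [|r|i|i]; first by rewrite size_map size_iota size_rows.
- rewrite size_rows => rL; rewrite nth_rows1 (nth_map 0%N) ?size_iota // nth_iota // add0n.
  apply/and3P; split.
  + rewrite /=; case: ltnP => rm; last by rewrite big1 // => i _; rewrite inE.
    rewrite (bigD1 (Ordinal (leq_trans rm mN))) //= inE eqxx big1 // => i ir.
    by rewrite inE; move: ir; rewrite -val_eqE /= => /negPf ->.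
  + apply/forallP => i; rewrite asetE inE /=; case: (ltnP r m) => rm; last by rewrite inE; case: (_ < _)%N.
    rewrite inE; case: eqP => [ir|_] /=; last by case: (_ < _)%N.
    rewrite -/(R r) -/t' -/w; case: ltnP => // h.
    have := col_len_lt (mem_rows rL) h; rewrite -colE tnth_mktuple nth_cat sza' ir rm.
    by rewrite nth_conj_spa // ltnn.
  + under eq_bigr do rewrite asetE inE.
    rewrite (reindex_inj (@perm_inj _ w)) /=; under eq_bigr do rewrite permK.
    have RN : (R r <= N)%N by apply: leq_trans LN; apply: (leq_conj_slen conjL); exact: mem_rows.
    by rewrite -big_mkcond /= (big_ord_narrow RN) sum1_card card_ord.
- rewrite big_top /= xseqE; have [iN|Ni] := ltnP i N; last first.
    rewrite big1 => [|r _]; last by rewrite aset_out.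
    by rewrite nth_default // size_cat sza' (leq_trans LN).
  rewrite (eq_bigr (fun r : 'I_(slen L) => ((w^-1)%g (Ordinal iN) < R r)%N : nat)).
    by rewrite rows_col_len -colE tnth_mktuple.
  by move=> r _; rewrite -[i]/(val (Ordinal iN)) asetE inE.
rewrite big_top !inE /= mem_iota sza' /= add0n.
have [im|mi] := ltnP i m.
  have iL : (i < slen L)%N by apply: leq_trans im _; exact: leq_addr.
  rewrite (bigD1 (Ordinal iL)) //= im inE eqxx big1 // => r; rewrite -val_eqE /= => ri.
  by case: ifP => _; rewrite inE // eq_sym (negPf ri).
rewrite big1 // => r _; case: ltnP => rm; rewrite inE //.
by case: eqP => // ir; rewrite ir leqNgt rm in mi.
Qed.

Lemma top_filling_uniq vs :
  filling N (rows L) (canon (spa L') (sps L')) vs -> vs = top_filling L L' N.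
Proof.
move=> vsP; have [sza' _ _ _ _] := sparP L'.
have szN : (size (spa L') + size (sps L') <= N)%N by rewrite sza'.
have [sz _ _ _] := vsP.
apply: (@eq_from_nth _ smon1) => [|r]; first by rewrite sz size_map size_iota size_rows.
rewrite sz size_rows => rL; rewrite (nth_map 0%N) ?size_iota // nth_iota // add0n.
exact: (filling_top conjL LN szN (spar_canon L') vsP).
Qed.

Lemma top_filling_before : pairwise before (top_filling L L' N).
Proof.
rewrite pairwise_map; have := iota_ltn_sorted 0 (slen L).
rewrite (sorted_pairwise ltn_trans); apply: sub_pairwise => r r' rr' /=.
apply/allP => i /= ir; apply/allP => j /= jr; move: ir jr => /=.
by case: ifP => _; rewrite inE // => /eqP ->; case: ifP => _; rewrite inE // => /eqP ->.
Qed.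

End TopFilling.

(** * An integer rank for superpartitions *)

Lemma spar_superseq n m (L : SPar n m) N : is_superseq m (spar_comp N L).
Proof.
have [sza srta srts _ _] := sparP L.
split=> p q; rewrite !tnth_mktuple !nth_cat sza.
  move=> pq qm; rewrite qm (ltn_trans pq qm).
  apply: (sorted_ltn_nth (leT := gtn) _ 0%N srta) => //.
  - by move=> y x z /= yx zy; exact: ltn_trans zy yx.
  - by rewrite inE sza (ltn_trans pq).
  - by rewrite inE sza.
move=> mp pq; rewrite (leq_gtF mp) (leq_gtF (leq_trans mp pq)).
have [qs|sq] := ltnP (q - m) (size (sps L)); last by rewrite [X in (X <= _)%N]nth_default.
apply: (sorted_leq_nth geq_trans_ (leqnn : reflexive geq) 0%N srts); rewrite ?inE //.
  by apply: leq_ltn_trans qs; exact: leq_sub2r.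
exact: leq_sub2r.
Qed.

Lemma spar_comp_eq n m (O L : SPar n m) N : (slen O <= N)%N -> (slen L <= N)%N ->
  spar_comp N O = spar_comp N L -> O = L.
Proof.
move=> ON LN e; have [szO _ _ _ _] := sparP O; have [szL _ _ _ _] := sparP L.
have mN : (m <= N)%N by apply: leq_trans ON; exact: leq_addr.
have ea : spa O = spa L.
  apply: (@eq_from_nth _ 0%N); rewrite szO ?szL // => i im.
  have := congr1 (fun t : N.-tuple nat => tnth t (Ordinal (leq_trans im mN))) e.
  by rewrite !tnth_mktuple !nth_cat szO szL im.
have pe : perm_eq (spar_comp N O) (spar_comp N L) by rewrite e.
have pa : perm_eq (spa O) (spa L) by rewrite ea.
have szON : (size (spa O) + size (sps O) <= N)%N by rewrite szO.
have szLN : (size (spa L) + size (sps L) <= N)%N by rewrite szL.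
have [_ es] := canon_eq (spar_canon O) (spar_canon L) pa szON szLN pe.
exact: spar_val_inj.
Qed.

Lemma leq_slen n m (L : SPar n m) : (slen L <= n + m)%N.
Proof.
have [_ _ _ s0 sumE] := sparP L; rewrite /slen addnC leq_add2r.
by apply: leq_trans (leq_size_sumn s0) _; rewrite -[X in (_ <= X)%N]sumE leq_addl.
Qed.

(** Adding up all partial sums turns strict dominance into a strict inequality of integers. *)
Definition prefix_sums N (t : N.-tuple nat) : nat := (\sum_(k < N.+1) sumn (take k t))%N.

Lemma dominance_prefix_sums N (s t : N.-tuple nat) : dominance s t ->
  (prefix_sums s <= prefix_sums t)%N /\ (prefix_sums s = prefix_sums t -> s = t).
Proof.
move=> /forallP dom; split; first by apply: leq_sum => k _; exact: dom.
move=> /(eq_leq_sum dom) e; apply: eq_from_tnth => j.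
have := e (Ordinal (ltn_ord j : (j.+1 < N.+1)%N)); have := e (widen_ord (leqnSn N) j).
rewrite /= !(take_nth 0%N) ?size_tuple // -!(tnth_nth 0%N) !sumn_rcons => ->.
exact: addnI.
Qed.

(* A numerical linear extension of the order appearing in the triangularity:
   dominance first, then the size of the fermionic part. *)
Definition spar_rank n m (L : SPar n m) : nat :=
  (n.+1 * prefix_sums (comp_plus (spar_comp (n + m) L)) + sumn (spa L))%N.

Lemma comp_plus_perm N (s t : N.-tuple nat) : comp_plus s = comp_plus t -> perm_eq s t.
Proof.
move=> /(congr1 val) /= e.
by rewrite -(permPl (permEl (perm_sort geq s))) e perm_sort.
Qed.

(** * Unitriangular expansion on the monomial superfunctions *)

Section Expansion.
Variables (n m : nat) (L L' : SPar n m).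
Hypothesis conjL : is_conjugate L L'.

Let f : sser := \prod_(r <- rows L) fac r.

Lemma fac_prod_top : f (canon (spa L') (sps L')) = 1.
Proof.
have [sza' _ _ _ _] := sparP L'.
apply: (@fac_prod_uniq (slen L') _ _ (top_filling L L' (slen L'))).
- apply: bounded_sbound; apply: leq_trans (sbound_canon_le _ _) _.
  by rewrite sza'.
- exact: top_filling_ok.
- exact: top_filling_uniq.
- exact: top_filling_before.
Qed.

Lemma fac_prod_filling N A S : (size A + size S <= N)%N ->
  f (canon A S) != 0 -> exists vs, filling N (rows L) (canon A S) vs.
Proof.
move=> szN; apply: fac_prod_neq0; apply: bounded_sbound.
exact: leq_trans (sbound_canon_le _ _) szN.
Qed.

Lemma fac_prod_spar A S : is_canon A S -> ~~ is_spar n m (A, S) -> f (canon A S) = 0.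
Proof.
move=> cAS; apply: contraNeq => /(fac_prod_filling (leqnn _))[vs vsP].
exact: (filling_spar (leqnn _) cAS vsP).
Qed.

Lemma fac_prod_lt (O : SPar n m) : f (canon (spa O) (sps O)) != 0 -> O != L' ->
  spar_lt O L' /\ (spar_rank O < spar_rank L')%N.
Proof.
move=> nz OL; have [szO _ _ _ sumO] := sparP O; have [szL' _ _ _ _] := sparP L'.
(* Used with two values of N: the larger of the two lengths, as in [spar_le], and n + m, as in
   [spar_rank]. *)
have key N : (slen O <= N)%N -> (slen L' <= N)%N ->
    dominance (comp_plus (spar_comp N O)) (comp_plus (spar_comp N L')) /\
    (comp_plus (spar_comp N O) = comp_plus (spar_comp N L') ->
      forall i, (i < m)%N -> (nth 0%N (spa O) i <= nth 0%N (spa L') i)%N).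
  move=> ON LN; have szN : (size (spa O) + size (sps O) <= N)%N by rewrite szO.
  have [vs vsP] := fac_prod_filling szN nz.
  split; first exact: (filling_dominance conjL LN vsP).
  move=> e i; exact: (filling_spa_le conjL LN szN (spar_canon O) vsP e).
split.
  rewrite /spar_lt OL /spar_le /comp_le; set N := maxn _ _.
  have [dom le_a] := key N (leq_maxl _ _) (leq_maxr _ _).
  rewrite dom andbT; case: eqP => //= e; apply: (bruhat_superseq (m := m)).
  - exact: spar_superseq.
  - exact: spar_superseq.
  - exact/comp_plus_perm/esym.
  - move=> p pm; rewrite !tnth_mktuple !nth_cat szO szL' pm; exact: le_a.
have [dom le_a] := key _ (leq_slen O) (leq_slen L').
have [le_D eq_D] := dominance_prefix_sums dom.
rewrite /spar_rank; move: le_D; rewrite leq_eqVlt => /predU1P[e|lt_D]; last first.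
  apply: leq_trans (leq_addr _ _).
  (* The weight [n.+1] exceeds the sum of any fermionic part, which is at most n, so a gain of one
     in the prefix sums outweighs it. *)
  apply: (@leq_trans (n.+1 * (prefix_sums (comp_plus (spar_comp (n + m) O))).+1)%N).
    by rewrite mulnS addnC ltn_add2r ltnS -[X in (_ <= X)%N]sumO leq_addr.
  by rewrite leq_mul2l lt_D orbT.
have {}e := eq_D e; rewrite e ltn_add2l.
have sumn_nth (s : seq nat) : size s = m -> sumn s = (\sum_(i < m) nth 0%N s i)%N.
  by move=> <-; rewrite sumnE (big_nth 0%N) big_mkord.
rewrite ltn_neqAle !sumn_nth // leq_sum ?andbT => [|i _]; last exact: le_a.
(* Equal fermionic sums together with the entrywise bound force equal fermionic parts, and then the
   symmetric parts agree because the sorted compositions do. *)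
apply: contra OL => /eqP /eq_leq_sum h.
have {}h : forall i : 'I_m, nth 0%N (spa O) i = nth 0%N (spa L') i.
  by apply: h => i; exact: le_a.
apply/eqP/(spar_comp_eq (leq_slen O) (leq_slen L')).
apply: (superseq_eq (spar_superseq O _) (spar_superseq L' _)).
  exact: comp_plus_perm.
by move=> p pm; rewrite !tnth_mktuple !nth_cat szO szL' pm (h (Ordinal pm)).
Qed.

Lemma fac_prod_expand : exists z : SPar n m -> int,
  [/\ f = \sum_O mono O *~ z O, z L' = 1
    & forall O, z O != 0 -> O != L' -> spar_lt O L' /\ (spar_rank O < spar_rank L')%N].
Proof.
have zE (O : SPar n m) : exists z : int, f (canon (spa O) (sps O)) = z%:~R.
  by have /intrP := fac_prod_int (rows L) (canon (spa O) (sps O)).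
have [z {}zE] := choice zE; exists z; split.
- rewrite [LHS](swap_inv_expand (n := n) (m := m)).
  + by apply: eq_bigr => O _; rewrite zE scaler_int.
  + exact: fac_prod_swap_inv.
  + exact: fac_prod_spar.
- by apply/eqP; rewrite -(@eqr_int rat) -zE fac_prod_top.
- by move=> O zO; apply: fac_prod_lt; rewrite zE intr_eq0.
Qed.

Lemma rows_prod : f = (\prod_(k <- rev (spa L)) telem k) * \prod_(k <- sps L) elem k.
Proof. by rewrite /f /rows big_cat !big_map. Qed.

End Expansion.

(** * The basis property *)

Lemma is_conjugate_sym n m (L L' : SPar n m) : is_conjugate L L' -> is_conjugate L' L.
Proof. by move=> h i j; have [-> ->] := h j i. Qed.

Lemma prod_rev_sign I (r : seq I) (F : I -> sser) :
  (forall i j, F i * F j = - (F j * F i)) ->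
  exists k, \prod_(i <- rev r) F i = (-1) ^+ k * \prod_(i <- r) F i.
Proof.
move=> anti; elim: r => [|i r [k IHr]].
  by exists 0%N; rewrite big_nil expr0 mulr1.
exists (k + size r)%N; rewrite rev_cons -cats1 big_cat big_seq1 big_cons /= IHr exprD -!mulrA.
congr (_ * _); elim: r {IHr} => [|j r IHr]; first by rewrite big_nil expr0 !mul1r mulr1.
rewrite big_cons /= -mulrA IHr [LHS]mulrA (commr_sign (F j) (size r)) -mulrA.
by rewrite exprS mulN1r mulNr -mulrN; congr (_ * _); rewrite !mulrA anti mulNr.
Qed.

(** [elem_spar] takes the fermionic factors in decreasing order; reversing them costs a sign, which
    is invertible over the integers. *)
Lemma elem_spar_sign n m (L : SPar n m) :
  exists k, elem_spar L = (-1) ^+ k * \prod_(r <- rows L) fac r.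
Proof.
have [k ek] := prod_rev_sign (spa L) telem_anticomm.
by exists k; rewrite rows_prod ek !mulrA -exprD -signr_odd oddD addbb expr0 mul1r.
Qed.

Lemma sser_signE k (f : sser) u : ((-1) ^+ k * f) u = (-1) ^+ k * f u.
Proof.
by rewrite -signr_odd -[in RHS]signr_odd; case: (odd k); rewrite ?expr0 ?expr1 ?mul1r // !mulN1r.
Qed.

Lemma sser_mulrzE (f : sser) (z : int) u : (f *~ z) u = z%:~R * f u.
Proof. by rewrite -scaler_int. Qed.

(** Among the L with a nonzero coefficient, one whose conjugate has maximal rank is chosen. At the
    canonical monomial of this conjugate no other term contributes, since it would come from a
    conjugate of larger rank. *)
Lemma elem_spar_free n m (c : SPar n m -> int) :
  \sum_L elem_spar L *~ c L = 0 -> forall L, c L = 0.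
Proof.
move=> c0 L0; apply/eqP/negP => /negP cL0.
have [cj cjP] := choice (@conjugate_exists n m).
have cj_inj : injective cj.
  move=> K L e; apply: (@conjugate_uniq _ _ (cj K)); apply: is_conjugate_sym => //.
  by rewrite e.
have [L cL maxL] := @arg_maxnP _ L0 (fun L => c L != 0) (fun L => spar_rank (cj L)) cL0.
have := congr1 (fun f : sser => f (canon (spa (cj L)) (sps (cj L)))) c0.
rewrite sser_sumE (bigD1 L) //= big1 ?addr0 => [|K KL]; rewrite sser_mulrzE.
  have [k ->] := elem_spar_sign L; rewrite sser_signE (fac_prod_top (cjP L)) mulr1.
  by move/eqP; rewrite [X in _ == X](_ : _ = 0) // mulf_eq0 signr_eq0 orbF intr_eq0 (negPf cL).
have [->|cK] := eqVneq (c K) 0; first by rewrite mul0r.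
have [k ->] := elem_spar_sign K; rewrite sser_signE.
apply/eqP; rewrite !mulf_eq0; apply/orP; right; apply/orP; right.
apply/negPn/negP => nz; have [|_] := fac_prod_lt (cjP K) nz.
  by rewrite (inj_eq cj_inj) eq_sym.
by rewrite ltnNge => /negP; apply; exact: maxL.
Qed.

Section Span.
Variables (n m : nat).

Definition elem_span (f : sser) : Prop :=
  exists c : SPar n m -> int, f = \sum_L elem_spar L *~ c L.

(** Membership is asked only where [z i] is nonzero, which is where triangularity lowers the rank
    and an induction hypothesis applies. *)
Lemma elem_span_sum (I : finType) (F : I -> sser) (z : I -> int) :
  (forall i, z i != 0 -> elem_span (F i)) -> elem_span (\sum_i F i *~ z i).
Proof.
move=> spF; have /choice[c cP] i : exists c : SPar n m -> int,
    F i *~ z i = \sum_L elem_spar L *~ c L.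
  have [->|/spF[c ->]] := eqVneq (z i) 0.
    by exists (fun=> 0); rewrite mulr0z big1 // => L _; rewrite mulr0z.
  by exists (fun L => c L * z i); rewrite mulrz_suml; apply: eq_bigr => L _; rewrite mulrzA.
exists (fun L => \sum_i c i L); rewrite (eq_bigr _ (fun i _ => cP i)) exchange_big /=.
by apply: eq_bigr => L _; rewrite mulrz_sumr.
Qed.

Lemma mono_elem_span (L : SPar n m) : elem_span (mono L).
Proof.
have [d] := ubnP (spar_rank L); elim: d L => // d IHd L dP.
have [K /is_conjugate_sym KL] := conjugate_exists L.
have [z [eK zL z_lt]] := fac_prod_expand KL.
have [k ek] := elem_spar_sign K.
(* The expansion of [elem_spar K], K the conjugate of L, is solved for its leading term [mono L]:
   the slot of L holds [elem_spar K] with its sign, and the other slots hold monomials of smaller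
   rank. *)
pose F (M : SPar n m) := if M == L then elem_spar K else mono M.
pose y (M : SPar n m) : int := if M == L then (-1) ^+ k else - z M.
have -> : mono L = \sum_M F M *~ y M.
  have eFK : elem_spar K *~ (-1) ^+ k = \sum_M mono M *~ z M.
    rewrite -eK ek -mulrzr rmorph_sign -mulrA commr_sign mulrA -exprD.
    by rewrite -signr_odd oddD addbb expr0 mul1r.
  rewrite (bigD1 L) //= /F /y eqxx eFK (bigD1 L) //= zL mulr1z -addrA -big_split.
  by rewrite big1 ?addr0 // => M /negPf -> /=; rewrite mulrNz addrN.
apply: elem_span_sum => M; rewrite /F /y; case: (eqVneq M L) => [_ _|ML]; last first.
  rewrite oppr_eq0 => /z_lt/(_ ML)[_ rk].
  by apply: IHd; apply: leq_trans rk _.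
exists (fun M => (M == K)%:R); rewrite (bigD1 K) //= eqxx mulr1z big1 ?addr0 //.
by move=> M' /negPf ->; rewrite mulr0z.
Qed.

End Span.

Theorem theorem3p1 (n m : nat) :
  (forall L L' : SPar n m, is_conjugate L L' ->
     exists N : SPar n m -> int,
       (\prod_(k <- rev (spa L)) telem k) * (\prod_(k <- sps L) elem k)
       = mono L' + \sum_(O : SPar n m | spar_lt O L') mono O *~ N O)
  /\ is_Zbasis (@symsuper n m) (@elem_spar n m).
Proof.
split=> [L L' conjL|].
  have [z [e zL' z_lt]] := fac_prod_expand conjL; exists z.
  rewrite -rows_prod e (bigD1 L') //= zL' mulr1z; congr (_ + _).
  rewrite big_mkcond [RHS]big_mkcond /=; apply: eq_bigr => O _.
  have [->|OL'] := eqVneq O L'; first by rewrite /spar_lt eqxx.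
  have [->|/z_lt/(_ OL')[-> _] //] := eqVneq (z O) 0.
  by rewrite mulr0z; case: ifP.
split; last 1 first.
- move=> f [c ->]; apply: elem_span_sum => L _; exact: mono_elem_span.
- move=> L; have [L' conjL] := conjugate_exists L.
  have [z [e _ _]] := fac_prod_expand conjL; have [k ek] := elem_spar_sign L.
  exists (fun O => z O * (-1) ^+ k); rewrite ek e mulr_sumr; apply: eq_bigr => O _.
  by rewrite mulrzA -[RHS]mulrzr rmorph_sign commr_sign.
exact: elem_spar_free.
Qed.
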